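(* Let $j,k\ge 1$ be integers. If $w\in S^{\mathrm{B}}_n$ globally avoids both the increasing pattern $12\cdots k(k+1)\in S_{k+1}$ and the decreasing pattern $(j+1)j\cdots 21\in S_{j+1}$, then $n\le \frac{kj}{2}$. Moreover, the number of signed permutations in $S^{\mathrm{B}}_{\lfloor kj/2\rfloor}$ that globally avoid both of these patterns is the square of the number of domino tableaux whose shape is the $j$-tuple \[ \begin{cases} (k,k,\ldots,k,k) & \text{if } kj \text{ is even, and}\\ (k,k,\ldots,k,k-1) & \text{if } kj \text{ is odd.} \end{cases} \]
   Context: Notation: $[n]=\{1,\dots,n\}$ and $[\pm n]=\{\pm1,\dots,\pm n\}$. Elements of the symmetric group $S_m$ are written in one-line notation $p(1)\cdots p(m)$. $S^{\mathrm{B}}_n$ is the set (group) of signed permutations of size $n$, i.e. bijections $w:[\pm n]\to[\pm n]$ with $w(-x)=-w(x)$ for all $x\in[n]$; by convention $|S^{\mathrm{B}}_0|=1$. Global avoidance: for $p\in S_m$, a signed permutation $w\in S^{\mathrm{B}}_n$ globally contains $p$ if there are indices $i_1<\cdots<i_m$ in $[\pm n]$ (in the usual order of the integers) such that $w(i_1)\cdots w(i_m)$ is order-isomorphic to $p$; otherwise $w$ globally avoids $p$. Domino tableau: a (standard) domino tableau of shape $\lambda$, where $\lambda$ is a partition with $|\lambda|=2n$, is a filling (tiling) of the Young diagram of $\lambda$ by $n$ dominoes (each covering two edge-adjacent boxes), labelled $1,\dots,n$ (each label used once), so that the labels increase along each row and column (the two boxes of a single domino carrying the same label). *)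

(* Defs.v *)
From mathcomp Require Import all_boot all_order all_fingroup all_algebra.

Set Implicit Arguments.
Unset Strict Implicit.
Unset Printing Implicit Defensive.

Import Order.TTheory GRing.Theory Num.Theory.

(* The index set [±n]: the pair (b, i) stands for the integer i + 1 if b is
   false, and for -(i + 1) if b is true. *)
Definition pmidx (n : nat) : Type := (bool * 'I_n)%type.

Definition pmval (n : nat) (x : pmidx n) : int :=
  (if x.1 then - x.2.+1%:Z else x.2.+1%:Z)%R.

Definition pmneg (n : nat) (x : pmidx n) : pmidx n := (~~ x.1, x.2).

Lemma pmval_neg (n : nat) (x : pmidx n) : pmval (pmneg x) = (- pmval x)%R.
Proof. by case: x => [[] i] //=; rewrite /pmval /= opprK. Qed.

Lemma pmval_inj (n : nat) : injective (@pmval n).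
Proof.
case=> [[] i] [[] j]; rewrite /pmval /=.
- by move/oppr_inj => [/val_inj ->].
- by [].
- by [].
- by case=> /val_inj ->.
Qed.

Lemma pmvalP (n : nat) (z : int) :
  (exists x : pmidx n, pmval x = z) <-> (z != 0)%R /\ (`|z| <= n)%N.
Proof.
split=> [[[[] i] <-]|[]].
- by split; last exact: ltn_ord.
- by split; last exact: ltn_ord.
case: z => [[//|m] _ /= lt_mn|m _ /= lt_mn].
- by exists (false, Ordinal lt_mn).
- by exists (true, Ordinal lt_mn); rewrite /pmval /= NegzE.
Qed.

Definition signed_perms (n : nat) : {set {perm pmidx n}} :=
  [set w : {perm pmidx n} | [forall x, w (pmneg x) == pmneg (w x)]].

Definition globally_contains (n m : nat) (w : {perm pmidx n}) (p : 'S_m) :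
    bool :=
  [exists i : {ffun 'I_m -> pmidx n},
    [forall a : 'I_m, forall b : 'I_m,
      (a < b)%N ==> (pmval (i a) < pmval (i b))%R] &&
    [forall a : 'I_m, forall b : 'I_m,
      (pmval (w (i a)) < pmval (w (i b)))%R == (p a < p b)%N]].

Definition globally_avoids (n m : nat) (w : {perm pmidx n}) (p : 'S_m) : bool :=
  ~~ globally_contains w p.

Definition increasing_pattern (m : nat) : 'S_m := 1%g.

Definition decreasing_pattern (m : nat) : 'S_m := perm (@rev_ord_inj m).

(* A shape is the sequence of its row lengths, possibly with trailing zeros. *)
Definition is_partition (la : seq nat) : bool := sorted geq la.

(* The boxes of the Young diagram; rows, columns and labels start at 0. *)
Definition box (la : seq nat) : Type :=
  {r : 'I_(size la) & 'I_(nth 0%N la r)}.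

Definition box_row (la : seq nat) (x : box la) : nat := tag x.

Definition box_col (la : seq nat) (x : box la) : nat := tagged x.

Definition edge_adjacent (la : seq nat) (x y : box la) : bool :=
  (box_row x == box_row y) &&
    ((box_col y == (box_col x).+1) || (box_col x == (box_col y).+1))
  || (box_col x == box_col y) &&
    ((box_row y == (box_row x).+1) || (box_row x == (box_row y).+1)).

Definition is_domino (la : seq nat) (D : {set box la}) : bool :=
  [exists x : box la, exists y : box la, edge_adjacent x y && (D == [set x; y])].

(* A domino tableau is given by the label of each box; the tiling is recovered
   as the family of label classes.  As the two boxes of a domino share their
   label, labels increase weakly along rows and columns. If |la| is odd, the
   set is empty, since n label classes of size 2 cannot cover the diagram. *)
Definition domino_tableaux (la : seq nat) :
    {set {ffun box la -> 'I_((sumn la)./2)}} :=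
  [set T : {ffun box la -> 'I_((sumn la)./2)} |
    [&& [forall l, is_domino [set x : box la | T x == l]],
        [forall x : box la, forall y : box la,
          (box_row x == box_row y) && (box_col x < box_col y)%N
            ==> (T x <= T y)%N] &
        [forall x : box la, forall y : box la,
          (box_col x == box_col y) && (box_row x < box_row y)%N
            ==> (T x <= T y)%N]]].

Definition near_rectangle (j k : nat) : seq nat :=
  if odd (k * j) then rcons (nseq j.-1 k) k.-1 else nseq j k.

Lemma near_rectangle_partition (j k : nat) : is_partition (near_rectangle j k).
Proof.
have geq_trans : transitive geq by move=> a b c /= h1 h2; exact: leq_trans h1.
rewrite /is_partition /near_rectangle; case: ifP => _.
  rewrite -cats1 sorted_pairwise // pairwise_cat /= andbT.
  apply/andP; split.
    by rewrite allrel1r; apply/allP => x /nseqP [-> _] /=; rewrite leq_pred.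
  by elim: j.-1 => //= i ->; rewrite andbT; apply/allP => x /nseqP [-> _] /=.
rewrite sorted_pairwise //; elim: j => //= i ->; rewrite andbT.
by apply/allP => x /nseqP [-> _] /=.
Qed.

(* Main.v *)
(* Let N = jk.  If a permutation of N points avoids both patterns, sending a point
   to the lengths of the longest decreasing and increasing subsequences ending
   there is a bijection onto the j x k rectangle (Erdos-Szekeres); recording it by
   positions and, after a vertical flip, by values identifies such permutations
   with pairs (P, Q) of standard tableaux of the rectangle.  Rotating the
   permutation by 180 degrees rotates P and Q, so signed permutations correspond
   to pairs of rotation-invariant tableaux.  If kj is odd, a fixed point 0 is first
   added; a chain through 0 has a half that can be reflected into a chain of at
   least the same length avoiding 0, so avoidance is not affected.

   On rectangular tableaux, rotation coincides with Schutzenberger's evacuation,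
   because both reverse Haiman's dual equivalences and the descents.  Evacuation
   is a product of toggles conjugate to the product of the commuting toggles of
   alternate steps, whose fixed points are the chains of partitions growing by
   dominoes, i.e. the domino tableaux.  So there are as many rotation-invariant
   tableaux as domino tableaux. *)

Require Import Defs.
From mathcomp Require Import all_boot all_order all_fingroup all_algebra.
From mathcomp Require Import zify.

Set Implicit Arguments.
Unset Strict Implicit.
Unset Printing Implicit Defensive.

Import Order.TTheory GRing.Theory Num.Theory.

(** * Toggles, promotion and evacuation of words *)

(** Apart from the domino tableaux of the statement, a tableau is never a filling here: it is the
    word of the boxes in the order of their labels, and toggles, promotion and dual equivalence are
    total operations on lists. The obstacle is that the identities relating toggles to dual
    equivalences and descents hold only on linear extensions. There the geometry enters through
    convexity: a box lying between two letters of a window of consecutive letters belongs to that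
    window. This restricts how the contents of at most four consecutive letters compare, so that
    each local identity becomes a finite check, and only commutations of distant toggles are needed
    to globalise it. *)

Section Toggle.
Variables (T : Type) (far : rel T).
Hypothesis far_sym : symmetric far.

(* Fomin's local rule for a growth diagram, on the word of the boxes added by a
   chain of partitions: two consecutive boxes are exchanged unless they form a
   domino, that is, exactly when they are [far] apart. *)
Fixpoint toggle (i : nat) (s : seq T) : seq T :=
  match i, s with
  | 0, a :: b :: s' => if far a b then b :: a :: s' else s
  | i'.+1, a :: s' => a :: toggle i' s'
  | _, _ => s
  end.

(** Here and in [evac], [m] is the highest position reached, so the first [m.+1] letters are
    affected; a whole word [s] takes [m = (size s).-1]. *)
Fixpoint promote (m : nat) (s : seq T) : seq T :=
  if m is m'.+1 then toggle m' (promote m' s) else s.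

Fixpoint unpromote (m : nat) (s : seq T) : seq T :=
  if m is m'.+1 then unpromote m' (toggle m' s) else s.

Fixpoint evac (m : nat) (s : seq T) : seq T :=
  if m is m'.+1 then evac m' (promote m s) else s.

Lemma size_toggle i s : size (toggle i s) = size s.
Proof.
by elim: i s => [|i IH] [|a s] //=; [case: s => //= b s; case: ifP | rewrite IH].
Qed.

Lemma toggleK i : involutive (toggle i).
Proof.
elim: i => [|i IH] [|a s] //=; last by rewrite IH.
by case: s => //= b s; case: ifP => /= H; rewrite ?H // far_sym H.
Qed.

Lemma toggle_comm i l s : i.+1 < l -> toggle i (toggle l s) = toggle l (toggle i s).
Proof.
elim: i l s => [|i IH] [|l] [|a s] //= Hl; last by rewrite IH.
by case: l Hl s => [|l] // _ [|b s] //=; case: ifP.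
Qed.

Lemma toggle_cat u i s : toggle (size u + i) (u ++ s) = u ++ toggle i s.
Proof. by elim: u => //= a u ->. Qed.

Lemma size_promote m s : size (promote m s) = size s.
Proof. by elim: m => //= m IH; rewrite size_toggle. Qed.

Lemma size_evac m s : size (evac m s) = size s.
Proof. by elim: m s => //= m IH s; rewrite IH size_toggle size_promote. Qed.

Lemma promoteK m : cancel (promote m) (unpromote m).
Proof. by elim: m => //= m IH s; rewrite toggleK IH. Qed.

Lemma unpromoteK m : cancel (unpromote m) (promote m).
Proof. by elim: m => //= m IH s; rewrite IH toggleK. Qed.

Lemma promote_toggle m l s : m < l -> promote m (toggle l s) = toggle l (promote m s).
Proof. by elim: m => //= m IH H; rewrite IH 1?toggle_comm //; lia. Qed.

Lemma evac_toggle m l s : m < l -> evac m (toggle l s) = toggle l (evac m s).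
Proof.
elim: m s => //= m IH s H.
by rewrite promote_toggle 1?toggle_comm 1?IH //; lia.
Qed.

Lemma evacE m s : evac m.+1 s = evac m (promote m.+1 s).
Proof. by []. Qed.

Lemma promoteE m s : promote m.+1 s = toggle m (promote m s).
Proof. by []. Qed.

(** The same product of toggles peeled from the other side: [evac m] uses only toggles below [m], so
    [toggle m.+1] passes through it. Together with [evacE] this makes [evac] an involution. *)
Lemma evacS m s : evac m.+1 s = unpromote m.+1 (evac m s).
Proof.
elim: m s => [//|m IH] s.
by rewrite evacE IH [promote m.+2 _]promoteE (@evac_toggle m m.+1).
Qed.

Lemma evacK m : involutive (evac m).
Proof. by elim: m => // m IH s; rewrite [evac m.+1 s]evacS evacE unpromoteK IH. Qed.

(* In the triangular growth diagram of evacuation, [zig] moves the path from the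
   top row to the antidiagonal, [flips] reflects it there by commuting toggles,
   and [zag] undoes [zig]. *)
Fixpoint zig (m : nat) (s : seq T) : seq T :=
  if m is m'.+2 then zig m' (promote m'.+1 s) else s.

Fixpoint zag (m : nat) (s : seq T) : seq T :=
  if m is m'.+2 then unpromote m'.+1 (zag m' s) else s.

Fixpoint flips (m : nat) (s : seq T) : seq T :=
  match m with
  | 0 => s
  | 1 => toggle 0 s
  | m'.+2 => toggle m'.+1 (flips m' s)
  end.

Lemma nat_ind2 (P : nat -> Prop) :
  P 0 -> P 1 -> (forall m, P m -> P m.+2) -> forall m, P m.
Proof.
move=> P0 P1 PS m; have [] // : P m /\ P m.+1.
by elim: m => // m [Pm Pm1]; split=> //; apply: PS.
Qed.

Lemma zigE m s : zig m.+2 s = zig m (promote m.+1 s).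
Proof. by []. Qed.

Lemma zagE m s : zag m.+2 s = unpromote m.+1 (zag m s).
Proof. by []. Qed.

Lemma flipsE m s : flips m.+2 s = toggle m.+1 (flips m s).
Proof. by []. Qed.

Lemma size_zig m s : size (zig m s) = size s.
Proof. by elim/nat_ind2: m s => // m IH s; rewrite zigE IH size_promote. Qed.

Lemma zigK m : cancel (zig m) (zag m).
Proof. by elim/nat_ind2: m => // m IH s; rewrite zagE zigE IH promoteK. Qed.

Lemma zagK m : cancel (zag m) (zig m).
Proof. by elim/nat_ind2: m => // m IH s; rewrite zagE zigE unpromoteK IH. Qed.

Lemma zig_toggle m l s : m <= l -> zig m (toggle l s) = toggle l (zig m s).
Proof.
elim/nat_ind2: m s => // m IH s ml.
by rewrite !zigE promote_toggle // IH //; lia.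
Qed.

Lemma flips_toggle m l s : m < l -> flips m (toggle l s) = toggle l (flips m s).
Proof.
elim/nat_ind2: m s => [//|s|m IH s] ml; first exact: toggle_comm.
by rewrite !flipsE IH; [apply: toggle_comm | lia].
Qed.

(** Peeling a promotion off each side of [evac m.+2] leaves [evac m] applied after a single
    [toggle m.+1]. That toggle commutes with [zig m] and [flips m] and becomes the new factor of
    [flips m.+2]. *)
Lemma evac_conj m s : evac m s = zag m (flips m (zig m s)).
Proof.
elim/nat_ind2: m s => // m IH s.
rewrite evacE promoteE evacS -promoteE promoteE zagE flipsE zigE.
by rewrite IH zig_toggle 1?flips_toggle.
Qed.
End Toggle.

(** * Linear extensions of the rectangle and dual equivalence *)

Section Words.
Variables (j k : nat).
Local Notation B := ('I_j * 'I_k)%type.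

Definition ble (a b : B) : bool := (a.1 <= b.1) && (a.2 <= b.2).
(* The content, column minus row, shifted by [j] to stay in [nat]. *)
Definition content (a : B) : nat := a.2 + (j - a.1).
Definition far (a b : B) : bool :=
  ((content a).+1 < content b) || ((content b).+1 < content a).
Definition between (z x y : B) : bool :=
  (content x < content z < content y) || (content y < content z < content x).

Lemma far_sym : symmetric far.
Proof. by move=> a b; rewrite /far orbC. Qed.

(* Haiman's elementary dual equivalence of the steps [i], [i+1], [i+2] (the dual
   Knuth relation, read on contents). *)
Fixpoint dualeq (i : nat) (s : seq B) : seq B :=
  match i, s with
  | 0, [:: a, b, c & s'] =>
      if between a b c then [:: a, c, b & s']
      else if between c a b then [:: b, a, c & s'] else s
  | i'.+1, a :: s' => a :: dualeq i' s'
  | _, _ => s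
  end.

Lemma size_dualeq i s : size (dualeq i s) = size s.
Proof.
elim: i s => [|i IH] [|a s] //=; last by rewrite IH.
by case: s => [|b [|c s]] //=; do 2?case: ifP.
Qed.

Lemma dualeq_cat u i s : dualeq (size u + i) (u ++ s) = u ++ dualeq i s.
Proof. by elim: u => //= a u ->. Qed.

Local Notation toggle := (toggle far).
Local Notation promote := (promote far).

Lemma dualeq_toggle_lt i l s : i.+1 < l -> dualeq l (toggle i s) = toggle i (dualeq l s).
Proof.
elim: i l s => [|i IH] [|l] [|a s] //= Hl; last by rewrite IH.
by case: l Hl s => [|l] // _ [|b s] //=; case: ifP.
Qed.

Lemma dualeq_toggle_gt i l s : i.+2 < l -> dualeq i (toggle l s) = toggle l (dualeq i s).
Proof.
elim: i l s => [|i IH] [|l] [|a s] //= Hl; last by rewrite IH.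
by case: l Hl s => [|[|l]] // _ [|b [|c s]] //=; do 2?case: ifP.
Qed.

Lemma dualeq_promote_le i m s : i < m ->
  dualeq m (promote i s) = promote i (dualeq m s).
Proof. by elim: i => //= i IH im; rewrite -IH 1?dualeq_toggle_lt //; lia. Qed.

Definition lin_ordered (s : seq B) := pairwise (fun a b => ~~ ble b a) s.
(** These words are the standard tableaux of the rectangle: [ble] is reflexive, so [lin_ordered]
    forbids repetitions and the length alone forces every box to occur. *)
Definition linext (s : seq B) := (size s == j * k) && lin_ordered s.
Definition convex (s : seq B) :=
  forall x y z, x \in s -> y \in s -> ble x z -> ble z y -> z \in s.

Lemma ble_refl a : ble a a.
Proof. by rewrite /ble !leqnn. Qed.

Lemma ble_trans : transitive ble.
Proof. by rewrite /ble => b a c; lia. Qed.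

Lemma ble_anti a b : ble a b -> ble b a -> a = b.
Proof.
case: a b => [a1 a2] [b1 b2]; rewrite /ble /= => H1 H2.
by congr (_, _); apply: val_inj => /=; lia.
Qed.

Lemma lin_ordered_uniq s : lin_ordered s -> uniq s.
Proof.
elim: s => //= a s IH /andP [/allP H /IH ->]; rewrite andbT.
by apply/negP => /H; rewrite ble_refl.
Qed.

Lemma linext_mem s x : linext s -> x \in s.
Proof.
case/andP => /eqP sz /lin_ordered_uniq us.
have := (uniq_min_size us (s2 := enum {: B})) .
have sub : {subset s <= enum {: B}} by move=> y _; rewrite mem_enum.
by case/(_ sub); rewrite ?sz -?cardE ?card_prod ?card_ord // => _ ->; rewrite mem_enum.
Qed.

(** A box between two letters of the window can be read neither before the smaller one nor after the
    larger one. *)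
Lemma linext_window u w v : linext (u ++ w ++ v) -> lin_ordered w /\ convex w.
Proof.
move=> lx; have /andP [_] := lx.
rewrite /lin_ordered !pairwise_cat => /and3P [/allrelP Huw _ /and3P [/allrelP Hwv Hw _]].
split=> // x y z xw yw xz zy; have := linext_mem z lx; rewrite !mem_cat.
case/or3P => // [zu|zv].
- by have := Huw z x zu; rewrite mem_cat xw xz => /(_ isT).
- by have := Hwv y z yw zv; rewrite zy.
Qed.

End Words.

Ltac box_lia :=
  repeat match goal with
  | a : (ordinal _ * ordinal _)%type |- _ =>
      let h1 := fresh in let h2 := fresh in
      have h1 := ltn_ord a.1; have h2 := ltn_ord a.2; move: h1 h2; generalize dependent a
  end; rewrite /ble /far /between /content; intros; lia.

(** * Contents of consecutive letters of a linear extension *)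

Section Windows.
Variables (j k : nat).
Local Notation B := ('I_j * 'I_k)%type.
Local Notation toggle := (toggle (@far j k)).
Local Notation promote := (promote (@far j k)).
Local Notation evac := (evac (@far j k)).

Lemma box_exists (r c : nat) : r < j -> c < k ->
  exists z : B, z.1 = r :> nat /\ z.2 = c :> nat.
Proof. by move=> rj ck; exists (Ordinal rj, Ordinal ck). Qed.

(** If the boxes are comparable, convexity makes them share an edge and their contents differ by
    one. If not, one is strictly above and to the right of the other, and the contents differ by at
    least two. *)
Lemma window2 (a b : B) : lin_ordered [:: a; b] -> convex [:: a; b] ->
  content a <> content b /\ (ble a b = ~~ far a b).
Proof.
rewrite /lin_ordered /= !andbT => lab cv.
have [ab|nab] := boolP (ble a b); last first.
  by clear cv; box_lia.
have no z : ble a z -> ble z b -> z = a \/ z = b.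
  move=> az zb; have := cv a b z; rewrite !inE !eqxx orbT az zb.
  by case/(_ isT isT isT isT)/orP => /eqP; auto.
clear cv.
case: (ltngtP a.1 b.1) (ltngtP a.2 b.2) => [r|r|r] [c|c|c]; try by (clear no; box_lia).
- have [z [z1 z2]] := box_exists (ltn_ord b.1) (ltn_ord a.2).
  by case: (no z); rewrite /ble ?z1 ?z2; try lia; move=> e; move: z1 z2; rewrite e; lia.
- have [rr|rr] := leqP b.1 a.1.+1; first by clear no; box_lia.
  have [||z [z1 z2]] := @box_exists a.1.+1 a.2; [by have := ltn_ord b.1; lia|by []|].
  by case: (no z); rewrite /ble ?z1 ?z2; try lia; move=> e; move: z1 z2; rewrite e; lia.
- have [rr|rr] := leqP b.2 a.2.+1; first by clear no; box_lia.
  have [||z [z1 z2]] := @box_exists a.1 a.2.+1; [by []|by have := ltn_ord b.2; lia|].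
  by case: (no z); rewrite /ble ?z1 ?z2; try lia; move=> e; move: z1 z2; rewrite e; lia.
Qed.

(** Two boxes of one diagonal enclose the boxes just below and just to the right of the first, on
    the two neighbouring diagonals. So equal contents cannot occur two letters apart, and three
    letters apart they determine the contents in between. *)
Lemma window_diagonal w (a d : B) : convex w -> a \in w -> d \in w -> ~~ ble d a ->
  content a = content d ->
  (exists2 z, z \in w & (content z).+1 = content a) /\
  (exists2 z, z \in w & content z = (content a).+1).
Proof.
move=> cv aw dw nda ad.
have [r c] : a.1 < d.1 /\ a.2 < d.2 by clear -nda ad; box_lia.
have [||z [z1 z2]] := @box_exists a.1.+1 a.2; [by have := ltn_ord d.1; lia|by []|].
have [||y [y1 y2]] := @box_exists a.1 a.2.+1; [by []|by have := ltn_ord d.2; lia|].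
split; [exists z|exists y]; try (by apply: (cv a d) => //; rewrite /ble; lia).
  by rewrite /content z1 z2; have := ltn_ord d.1; lia.
by rewrite /content y1 y2; lia.
Qed.

Lemma linext_window2 u (a b : B) v : linext (u ++ [:: a, b & v]) ->
  content a <> content b /\ ble a b = ~~ far a b.
Proof. by case/(@linext_window _ _ u [:: a; b] v); apply: window2. Qed.

Lemma linext_window3 u (a b c : B) v : linext (u ++ [:: a, b, c & v]) ->
  content a <> content c.
Proof.
case/(@linext_window _ _ u [:: a; b; c] v) => lin cv ac.
have nca : ~~ ble c a by move: lin; rewrite /lin_ordered /=; case/and3P => /and3P [].
have [||[z zw zc] [y yw yc]] := window_diagonal cv (a := a) (d := c) _ _ nca ac;
  rewrite ?inE ?eqxx ?orbT //.
move: zw yw; rewrite !inE => /or3P [] /eqP ez /or3P [] /eqP ey; subst; lia.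
Qed.

Lemma linext_window4 u (a b c d : B) v : linext (u ++ [:: a, b, c, d & v]) ->
  content a = content d ->
  ((content b).+1 = content a /\ content c = (content a).+1) \/
  ((content c).+1 = content a /\ content b = (content a).+1).
Proof.
case/(@linext_window _ _ u [:: a; b; c; d] v) => lin cv ad.
have nda : ~~ ble d a by move: lin; rewrite /lin_ordered /=; case/and4P => /and4P [].
have [||[z zw zc] [y yw yc]] := window_diagonal cv (a := a) (d := d) _ _ nda ad;
  rewrite ?inE ?eqxx ?orbT //.
move: zw yw; rewrite !inE => /or4P [] /eqP ez /or4P [] /eqP ey; subst; lia.
Qed.

Lemma split_window2 (T : Type) (i : nat) (s : seq T) : i.+1 < size s ->
  exists u a b v, s = u ++ [:: a, b & v] /\ size u = i.
Proof.
move=> lt; exists (take i s); rewrite size_takel; last by lia.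
case E: (drop i s) => [|a [|b v]]; try by (have := size_drop i s; rewrite E /=; lia).
by exists a, b, v; rewrite -E cat_take_drop.
Qed.

Lemma split_window3 (T : Type) (i : nat) (s : seq T) : i.+2 < size s ->
  exists u a b c v, s = u ++ [:: a, b, c & v] /\ size u = i.
Proof.
move=> lt; exists (take i s); rewrite size_takel; last by lia.
case E: (drop i s) => [|a [|b [|c v]]]; try by (have := size_drop i s; rewrite E /=; lia).
by exists a, b, c, v; rewrite -E cat_take_drop.
Qed.

Lemma split_window4 (T : Type) (i : nat) (s : seq T) : i.+3 < size s ->
  exists u a b c d v, s = u ++ [:: a, b, c, d & v] /\ size u = i.
Proof.
move=> lt; exists (take i s); rewrite size_takel; last by lia.
case E: (drop i s) => [|a [|b [|c [|d v]]]]; try by (have := size_drop i s; rewrite E /=; lia).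
by exists a, b, c, d, v; rewrite -E cat_take_drop.
Qed.

Lemma lin_ordered_swap (u : seq B) a b v : lin_ordered (u ++ [:: a, b & v]) -> ~~ ble a b ->
  lin_ordered (u ++ [:: b, a & v]).
Proof.
rewrite /lin_ordered !pairwise_cat /= => /and3P [H -> /and3P [/andP [_ ->] -> ->]] ->.
rewrite !andbT /=; apply/allrelP => x y xu yv.
by move/allrelP: H; apply=> //; move: yv; rewrite !inE => /or3P [] ->; rewrite ?orbT.
Qed.

Lemma linext_swap (u : seq B) a b v : linext (u ++ [:: a, b & v]) -> far a b ->
  linext (u ++ [:: b, a & v]).
Proof.
move=> lx fab; have [_ e] := linext_window2 lx.
case/andP: lx => sz lin; rewrite /linext lin_ordered_swap ?e ?fab // andbT.
by move: sz; rewrite !size_cat.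
Qed.

Lemma toggle_big i (s : seq B) : size s <= i.+1 -> toggle i s = s.
Proof.
by elim: i s => [|i IH] [|a s] //= sz; [case: s sz | rewrite IH].
Qed.

Lemma linext_toggle i (s : seq B) : linext s -> linext (toggle i s).
Proof.
have [lt|ge] := ltnP i.+1 (size s); last by rewrite toggle_big.
have [u [a [b [v [-> <-]]]]] := split_window2 lt.
rewrite -[X in toggle X]addn0 toggle_cat /=; case: ifP => // fab lx.
exact: linext_swap.
Qed.

Lemma linext_dualeq i (s : seq B) : linext s -> linext (dualeq i s).
Proof.
have [lt|ge] := ltnP i.+2 (size s); last first.
  suff -> : dualeq i s = s by [].
  by elim: i s ge => [|i IH] [|a s] //= sz; [case: s sz => [|b []] | rewrite IH].
have [u [a [b [c [v [-> <-]]]]]] := split_window3 lt.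
rewrite -[X in dualeq X]addn0 dualeq_cat /=; case: ifP => [bt lx|_].
  have := @linext_swap (rcons u a) b c v; rewrite -!cats1 -!catA /=; apply=> //.
  by move: bt; rewrite /between /far; lia.
case: ifP => // bt lx.
by apply: linext_swap => //; move: bt; rewrite /between /far; lia.
Qed.

Lemma linext_promote m (s : seq B) : linext s -> linext (promote m s).
Proof. by elim: m => //= m IH lx; apply/linext_toggle/IH. Qed.

Lemma linext_unpromote m (s : seq B) : linext s -> linext (unpromote (@far j k) m s).
Proof. by elim: m s => //= m IH s lx; apply/IH/linext_toggle. Qed.

Lemma linext_evac m (s : seq B) : linext s -> linext (evac m s).
Proof. by elim: m s => //= m IH s lx; apply/IH/linext_toggle/linext_promote. Qed.

Lemma linext_zig m (s : seq B) : linext s -> linext (zig (@far j k) m s).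
Proof.
by elim/nat_ind2: m s => // m IH s lx; rewrite zigE; apply/IH/linext_promote.
Qed.

Lemma linext_zag m (s : seq B) : linext s -> linext (zag (@far j k) m s).
Proof.
by elim/nat_ind2: m s => // m IH s lx; rewrite zagE; apply/linext_unpromote/IH.
Qed.

(* Sliding a box past three others commutes with dual equivalence; the proof is
   a finite check on the relative position of the four contents. *)
Lemma toggle3_dualeq i (s : seq B) : i.+3 < size s -> linext s ->
  toggle i.+2 (toggle i.+1 (toggle i (dualeq i.+1 s))) =
  dualeq i (toggle i.+2 (toggle i.+1 (toggle i s))).
Proof.
move=> lt; have [u [a [b [c [d [v [-> su]]]]]]] := split_window4 lt.
move=> lx.
have [ab _] := linext_window2 lx.
have [bc _] := @linext_window2 (rcons u a) b c (d :: v) ltac:(by rewrite cat_rcons).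
have [cd _] := @linext_window2 (rcons (rcons u a) b) c d v ltac:(by rewrite !cat_rcons).
have ac := linext_window3 lx.
have bd := @linext_window3 (rcons u a) b c d v ltac:(by rewrite cat_rcons).
have ad := linext_window4 lx.
have E n w : toggle (i + n) (u ++ w) = u ++ toggle n w by rewrite -su toggle_cat.
have F n w : dualeq (i + n) (u ++ w) = u ++ dualeq n w by rewrite -su dualeq_cat.
rewrite -[i]addn0 -!addnS !(E, F); congr (_ ++ _).
clear E F lx su lt; rewrite /=.
repeat (case: ifP => /=; rewrite /far /between => ?; try by exfalso; lia); try by [].
Qed.

End Windows.

(** * Evacuation reverses dual equivalences and descents *)

Section Evac.
Variables (j k : nat).
Local Notation B := ('I_j * 'I_k)%type.
Local Notation toggle := (toggle (@far j k)).
Local Notation promote := (promote (@far j k)).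
Local Notation evac := (evac (@far j k)).
Implicit Types (s u v : seq B) (a b c : B).

(** Promotion carries one box past the window, which moves one place to the left. The toggles [i],
    [i.+1], [i.+2] do this by [toggle3_dualeq]; the lower and the higher ones are disjoint from the
    window. *)
Lemma promote_dualeq i m s : i.+2 < m -> m < size s -> linext s ->
  promote m (dualeq i.+1 s) = dualeq i (promote m s).
Proof.
elim: m => // m IH im ms lx.
have [e|ne] := eqVneq m i.+2.
  rewrite e -[LHS]/(toggle i.+2 (toggle i.+1 (toggle i (promote i (dualeq i.+1 s))))).
  rewrite -dualeq_promote_le // toggle3_dualeq ?size_promote //; last exact: linext_promote.
  by lia.
by rewrite !promoteE IH ?dualeq_toggle_gt //; lia.
Qed.

Lemma linext_head a s x : linext (a :: s) -> ble a x.
Proof.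
move=> lx; have [||z [z1 z2]] := @box_exists j k 0 0.
- by have := ltn_ord a.1; lia.
- by have := ltn_ord a.2; lia.
have zx y : ble z y by rewrite /ble z1 z2.
have := linext_mem z lx; rewrite inE => /orP [/eqP <- //|zs].
by case/and3P: lx => _ /allP /(_ z zs); rewrite zx.
Qed.

Lemma evac2_dualeq s : 2 < size s -> linext s ->
  evac 2 (dualeq 0 s) = dualeq 0 (evac 2 s).
Proof.
case: s => [|a [|b [|c v]]] // _ lx.
have [ab Hab] := @linext_window2 _ _ [::] a b (c :: v) lx.
have [bc _] := @linext_window2 _ _ [:: a] b c v lx.
have ac := @linext_window3 _ _ [::] a b c v lx.
rewrite (linext_head b lx) in Hab.
(* If [b] and [c] can be exchanged, then [c] can also be read right after the first box, which lies
   below everything. *)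
have bc' : far b c -> ~~ far a c.
  move=> /(@linext_swap _ _ [:: a] b c v lx) lx'.
  have [_ <-] := @linext_window2 _ _ [::] a c (b :: v) lx'.
  exact: linext_head lx.
move: Hab bc'; rewrite /far => /esym Hab bc'; clear lx.
rewrite /=.
by repeat (case: ifP => /=; rewrite /far /between => ?; try by exfalso; lia).
Qed.

(** Each promotion moves the window one place to the left, until it consists of the first three
    letters. *)
Lemma evac_dualeq_last m s : m.+2 < size s -> linext s ->
  evac m.+2 (dualeq m s) = dualeq 0 (evac m.+2 s).
Proof.
elim: m s => [|m IH] s ms lx; first exact: evac2_dualeq.
rewrite evacE promote_dualeq // IH ?size_promote //; [lia | exact: linext_promote].
Qed.

(* The mirror image of [evac_dualeq_last], since evacuation is an involution. *)
Lemma evac_dualeq_first m s : m.+2 < size s -> linext s ->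
  evac m.+2 (dualeq 0 s) = dualeq m (evac m.+2 s).
Proof.
move=> ms lx; have := evac_dualeq_last (m := m) (s := evac m.+2 s).
rewrite size_evac (evacK (@far_sym j k)) => <- //; last exact: linext_evac.
by rewrite (evacK (@far_sym j k)).
Qed.

Lemma evac_dualeq m i s : m.+2 < size s -> i <= m -> linext s ->
  evac m.+2 (dualeq i s) = dualeq (m - i) (evac m.+2 s).
Proof.
elim: i m s => [|i IH] [|m] s ms im lx; rewrite ?subn0 ?subSS //; try exact: evac_dualeq_first.
rewrite evacE promote_dualeq // IH ?size_promote //; [lia | exact: linext_promote].
Qed.

(** On a linear extension this is the usual descent of a tableau: the content drops exactly when the
    next box is in a lower row. *)
Fixpoint descent (i : nat) (s : seq B) : bool :=
  match i, s with
  | 0, [:: a, b & _] => content b < content a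
  | i'.+1, _ :: s' => descent i' s'
  | _, _ => false
  end.

Lemma descent_cat u i s : descent (size u + i) (u ++ s) = descent i s.
Proof. by elim: u. Qed.

Lemma descent_toggle_lt i l s : i.+1 < l -> descent l (toggle i s) = descent l s.
Proof.
elim: i l s => [|i IH] [|l] [|a s] //= Hl; last by rewrite IH.
by case: l Hl s => [|l] // _ [|b s] //=; case: ifP.
Qed.

Lemma descent_toggle_gt i l s : i.+1 < l -> descent i (toggle l s) = descent i s.
Proof.
elim: i l s => [|i IH] [|l] [|a s] //= Hl; last by rewrite IH.
by case: l Hl s => [|l] // _ [|b s] //=.
Qed.

Lemma descent_promote_le i m s : i < m -> descent m (promote i s) = descent m s.
Proof. by elim: i => // i IH im; rewrite promoteE descent_toggle_lt ?IH //; lia. Qed.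

Lemma descent_toggle2 i s : i.+2 < size s -> linext s ->
  descent i (toggle i.+1 (toggle i s)) = descent i.+1 s.
Proof.
move=> lt; have [u [a [b [c [v [-> su]]]]]] := split_window3 lt.
move=> lx.
have [ab _] := linext_window2 lx.
have [bc _] := @linext_window2 _ _ (rcons u a) b c v ltac:(by rewrite cat_rcons).
have ac := linext_window3 lx.
have E n w : toggle (i + n) (u ++ w) = u ++ toggle n w by rewrite -su toggle_cat.
have F n w : descent (i + n) (u ++ w) = descent n w by rewrite -su descent_cat.
rewrite -[i]addn0 -!addnS !(E, F); clear E F lx su lt; rewrite /=.
repeat (case: ifP => /=; rewrite /far => ?; try by exfalso; lia); lia.
Qed.

Lemma descent_promote i m s : i.+1 < m -> m < size s -> linext s ->
  descent i (promote m s) = descent i.+1 s.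
Proof.
elim: m => // m IH im ms lx.
have [e|ne] := eqVneq m i.+1.
  rewrite e -[promote _ _]/(toggle i.+1 (toggle i (promote i s))).
  by rewrite descent_toggle2 ?size_promote ?descent_promote_le ?linext_promote //; lia.
by rewrite !promoteE descent_toggle_gt ?IH //; lia.
Qed.

Lemma descent_evac_last m s : m.+1 < size s -> linext s ->
  descent 0 (evac m.+1 s) = descent m s.
Proof.
elim: m s => [|m IH] s ms lx.
  case: s ms lx => [|a [|b v]] // _ lx; rewrite /=.
  have [_ Hab] := @linext_window2 _ _ [::] a b v lx.
  by rewrite (linext_head b lx) in Hab; case: (far a b) Hab.
rewrite evacE IH ?size_promote ?descent_promote //; [lia | exact: linext_promote].
Qed.

Lemma descent_evac_first m s : m.+1 < size s -> linext s ->
  descent m (evac m.+1 s) = descent 0 s.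
Proof.
move=> ms lx; have := descent_evac_last (m := m) (s := evac m.+1 s).
by rewrite size_evac (evacK (@far_sym j k)) => <- //; exact: linext_evac.
Qed.

Lemma descent_evac m i s : m.+1 < size s -> i <= m -> linext s ->
  descent (m - i) (evac m.+1 s) = descent i s.
Proof.
elim: i m s => [|i IH] [|m] s ms im lx; rewrite ?subn0 ?subSS //;
  try exact: descent_evac_first.
rewrite evacE IH ?size_promote ?descent_promote //; [lia | exact: linext_promote].
Qed.

End Evac.

Lemma pairwise_rev (T : Type) (r : rel T) (s : seq T) :
  pairwise r (rev s) = pairwise (fun a b => r b a) s.
Proof.
elim: s => //= a s IH; rewrite rev_cons pairwise_rcons IH all_rev.
by congr (_ && _).
Qed.

(** * Evacuation of a rectangular tableau is its rotation *)

Section Rotation.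
Variables (j k : nat).
Local Notation B := ('I_j * 'I_k)%type.
Local Notation toggle := (toggle (@far j k)).
Local Notation evac := (evac (@far j k)).
Implicit Types (s u v : seq B) (a b c : B).

Definition rotbox a : B := (rev_ord a.1, rev_ord a.2).
Definition rotate s := rev (map rotbox s).

Lemma rotboxK : involutive rotbox.
Proof. by case=> a1 a2; rewrite /rotbox /= !rev_ordK. Qed.

Lemma content_rotbox a : content (rotbox a) + content a = j + k.
Proof. by rewrite /content /=; have := ltn_ord a.1; have := ltn_ord a.2; lia. Qed.

Lemma ble_rotbox a b : ble (rotbox a) (rotbox b) = ble b a.
Proof.
rewrite /ble /=.
by have := ltn_ord a.1; have := ltn_ord a.2; have := ltn_ord b.1; have := ltn_ord b.2; lia.
Qed.

Lemma far_rotbox a b : far (rotbox a) (rotbox b) = far a b.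
Proof.
rewrite /far.
by have := content_rotbox a; have := content_rotbox b; lia.
Qed.

Lemma between_rotbox a b c : between (rotbox a) (rotbox b) (rotbox c) = between a b c.
Proof.
rewrite /between.
by have := content_rotbox a; have := content_rotbox b; have := content_rotbox c; lia.
Qed.

Lemma between_sym a b c : between a b c = between a c b.
Proof. by rewrite /between orbC. Qed.

Lemma size_rotate s : size (rotate s) = size s.
Proof. by rewrite size_rev size_map. Qed.

Lemma rotateK : involutive rotate.
Proof.
move=> s; rewrite /rotate map_rev revK -map_comp map_id_in // => x _.
exact: rotboxK.
Qed.

Lemma rotate_cat u v : rotate (u ++ v) = rotate v ++ rotate u.
Proof. by rewrite /rotate map_cat rev_cat. Qed.

Lemma linext_rotate s : linext s -> linext (rotate s).
Proof.
rewrite /linext size_rotate => /andP [-> /=].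
rewrite /lin_ordered /rotate pairwise_rev pairwise_map.
by apply: sub_pairwise => a b /=; rewrite ble_rotbox.
Qed.

Lemma rotate_dualeq i s : i.+2 < size s ->
  rotate (dualeq i s) = dualeq (size s - i.+3) (rotate s).
Proof.
move=> lt; have [u [a [b [c [v [-> <-]]]]]] := split_window3 lt.
rewrite -[X in dualeq X]addn0 dualeq_cat !rotate_cat.
have -> : size (u ++ [:: a, b, c & v]) - (size u).+3 = size (rotate v) + 0.
  by rewrite size_cat size_rotate /=; lia.
rewrite (rotate_cat [:: a; b; c] v) -!catA dualeq_cat /=.
rewrite !between_rotbox (between_sym c b a) (between_sym a c b).
(* Reversing the window exchanges the two moves of [dualeq]; they exclude each other, so the order
   in which they are tested does not matter. *)
case: (ifP (between a b c)) => [H1|_]; case: (ifP (between c a b)) => [H2|_];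
  rewrite ?(rotate_cat [:: _; _; _] v) -?catA //.
by move: H1 H2; rewrite /between; lia.
Qed.

Lemma rotate_toggle i s : i.+1 < size s ->
  rotate (toggle i s) = toggle (size s - i.+2) (rotate s).
Proof.
move=> lt; have [u [a [b [v [-> <-]]]]] := split_window2 lt.
rewrite -[X in toggle X]addn0 toggle_cat !rotate_cat.
have -> : size (u ++ [:: a, b & v]) - (size u).+2 = size (rotate v) + 0.
  by rewrite size_cat size_rotate /=; lia.
rewrite (rotate_cat [:: a; b] v) -!catA toggle_cat /=.
rewrite far_rotbox (far_sym b a); case: ifP => _.
  by rewrite (rotate_cat [:: b; a] v) -catA.
by rewrite (rotate_cat [:: a; b] v) -catA.
Qed.

Lemma descent_rotate i s : i.+1 < size s ->
  descent (size s - i.+2) (rotate s) = descent i s.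
Proof.
move=> lt; have [u [a [b [v [-> <-]]]]] := split_window2 lt.
rewrite -[X in _ = descent X _]addn0 descent_cat !rotate_cat.
have -> : size (u ++ [:: a, b & v]) - (size u).+2 = size (rotate v) + 0.
  by rewrite size_cat size_rotate /=; lia.
rewrite (rotate_cat [:: a; b] v) -!catA descent_cat /=.
by have := content_rotbox a; have := content_rotbox b; lia.
Qed.

Lemma dualeq_big i s : size s <= i.+2 -> dualeq i s = s.
Proof.
by elim: i s => [|i IH] [|a s] //= sz; [case: s sz => [|b []] | rewrite IH].
Qed.

Definition rotevac s := rotate (evac (size s).-1 s).

Lemma rotevac_dualeq i s : linext s -> rotevac (dualeq i s) = dualeq i (rotevac s).
Proof.
move=> lx; have [lt|ge] := ltnP i.+2 (size s); last first.
  by rewrite !dualeq_big // /rotevac size_rotate size_evac.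
rewrite /rotevac size_dualeq; case E: (size s) => [|[|[|m]]]; try lia.
rewrite -[_.-1]/m.+2 evac_dualeq // ?E //; last by lia.
rewrite rotate_dualeq size_evac E; last by lia.
by congr dualeq; lia.
Qed.

Lemma descent_rotevac i s : i.+1 < size s -> linext s ->
  descent i (rotevac s) = descent i s.
Proof.
move=> lt lx; rewrite /rotevac; case E: (size s) => [|[|m]]; try lia.
rewrite -[_.-1]/m.+1 -[in RHS](@descent_evac _ _ m) ?E //; last by lia.
rewrite -(@descent_rotate (m - i)) size_evac E; last by lia.
by congr descent; lia.
Qed.

Lemma linext_rotevac s : linext s -> linext (rotevac s).
Proof. by move=> lx; apply/linext_rotate/linext_evac. Qed.

End Rotation.

(** * Dual equivalence connects the linear extensions of a shape *)

Section Connected.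
Variables (j k : nat).
Local Notation B := ('I_j * 'I_k)%type.
Implicit Types (s u v : seq B) (a b c : B).

Definition downset s := forall a b, a \in s -> ble b a -> b \in s.

(** Above the meet of [a] and [b] but above neither, [c] has a row from [a.1] to below [b.1] and a
    column from [b.2] to below [a.2]. *)
Lemma between_meet a b c : a.1 < b.1 -> ble (a.1, b.2) c ->
  ~~ ble b a -> ~~ ble a c -> ~~ ble b c -> between c a b.
Proof. by rewrite {1}/ble /= => ab; box_lia. Qed.

Lemma ble_height a b : ble a b -> b.1 + b.2 <= a.1 + a.2 -> b = a.
Proof. by move=> ab le; apply: ble_anti => //; move: ab le; box_lia. Qed.

(* Any maximal element above the meet of [a] and [b] will do. *)
Lemma between_corner s a b : downset s -> a \in s -> b \in s -> ~~ ble a b -> ~~ ble b a ->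
  (forall x, x \in s -> ble a x -> x = a) -> (forall x, x \in s -> ble b x -> x = b) ->
  exists c, [/\ c \in s, c != a, c != b, between c a b &
    forall x, x \in s -> ble c x -> [\/ x = a, x = b | x = c]].
Proof.
wlog ab : a b / a.1 < b.1.
  move=> H ds as_ bs nab nba ma mb; case: (ltngtP a.1 b.1) => ab; first exact: H.
    have [c [cs ca cb bt mc]] := H b a ab ds bs as_ nba nab mb ma.
    exists c; split=> //; first by rewrite between_sym.
    move=> x xs cx; case: (mc x xs cx) => ->;
      by [constructor 2 | constructor 1 | constructor 3].
  by move: nab nba; rewrite /ble ab leqnn /=; case: leqP => //= /ltnW ->.
move=> ds as_ bs nab nba ma mb.
have ab2 : b.2 < a.2 by move: nab ab; clear; box_lia.
pose M : B := (a.1, b.2).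
have Ms : M \in s by apply: (ds a) => //; rewrite /ble /M /= leqnn ltnW.
pose Q x := [&& x \in s, x != a, x != b & ble M x].
have QM : Q M.
  rewrite /Q Ms ble_refl andbT /=; apply/andP; split; apply/eqP => e.
    by move: ab2; rewrite -e ltnn.
  by move: ab; rewrite -e ltnn.
case: (arg_maxnP (fun x : B => x.1 + x.2) QM) => c /and4P [cs ca cb Mc] cmax.
have nac : ~~ ble a c by apply/negP => /(ma c cs)/eqP; apply/negP.
have nbc : ~~ ble b c by apply/negP => /(mb c cs)/eqP; apply/negP.
exists c; split=> //.
  exact: between_meet Mc nba nac nbc.
move=> x xs cx; have [->|xa] := eqVneq x a; first by constructor.
have [->|xb] := eqVneq x b; first by constructor.
constructor 3; have := cmax x; rewrite /Q xs xa xb (ble_trans Mc cx) => /(_ isT) le.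
exact: ble_height.
Qed.

Lemma lin_ordered_rcons s a :
  lin_ordered (rcons s a) = all (fun x => ~~ ble a x) s && lin_ordered s.
Proof. by rewrite /lin_ordered pairwise_rcons. Qed.

Lemma lin_ordered_perm_max s a : lin_ordered (rcons s a) ->
  forall x, x \in rcons s a -> ble a x -> x = a.
Proof.
rewrite lin_ordered_rcons => /andP [/allP H _] x; rewrite mem_rcons inE => /orP [/eqP //|/H].
by move/negbTE->.
Qed.

Lemma downset_belast s a : lin_ordered (rcons s a) -> downset (rcons s a) -> downset s.
Proof.
move=> lin ds x y xs yx; have := ds x y; rewrite !mem_rcons !inE xs orbT => /(_ isT yx).
case/orP => // /eqP e; move: lin; rewrite lin_ordered_rcons => /andP [/allP /(_ x xs)].
by rewrite -e yx.
Qed.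

(* Haiman: tableaux of the same straight shape are dual equivalent.  Two words
   ending in different corners [a], [b] are linked through words ending in
   [c; b; a] and [c; a; b], for a corner [c] whose content lies between. *)
Lemma dualeq_connected (P : seq B -> Prop) : (forall i s, P s -> P (dualeq i s)) ->
  forall s s' u, lin_ordered s -> lin_ordered s' -> downset s -> perm_eq s s' ->
  P (s ++ u) -> P (s' ++ u).
Proof.
move=> HP s; have [n] := ubnP (size s); elim: n s => // n IH s.
case/lastP: s => [|s a]; first by move=> _ s' u _ _ _ /perm_size/esym/eqP/nilP ->.
rewrite size_rcons => sn s'; case/lastP: s' => [|s' b] u lin lin' ds pe.
  by have := perm_size pe; rewrite size_rcons.
have same t t' x w : size t < n -> lin_ordered (rcons t x) -> lin_ordered (rcons t' x) ->
    downset (rcons t x) -> perm_eq (rcons t x) (rcons t' x) ->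
    P (rcons t x ++ w) -> P (rcons t' x ++ w).
  move=> tn lt lt' dt pt; rewrite !cat_rcons; apply: IH => //.
  - by move: lt; rewrite lin_ordered_rcons => /andP [].
  - by move: lt'; rewrite lin_ordered_rcons => /andP [].
  - exact: downset_belast dt.
  - by move: pt; rewrite perm_rcons perm_sym perm_rcons perm_cons perm_sym.
have [e|ab] := eqVneq a b; first by subst b; apply: same.
have pm : rcons s a =i rcons s' b by exact: perm_mem.
have ma := lin_ordered_perm_max lin.
have mb : forall x, x \in rcons s a -> ble b x -> x = b.
  by move=> x; rewrite pm; exact: lin_ordered_perm_max.
have ain : a \in rcons s a by rewrite mem_rcons inE eqxx.
have bin : b \in rcons s a by rewrite pm mem_rcons inE eqxx.
have nab : ~~ ble a b by apply/negP => /(ma _ bin) e; rewrite e eqxx in ab.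
have nba : ~~ ble b a by apply/negP => /(mb _ ain) e; rewrite e eqxx in ab.
have [c [cin ca cb bt mc]] := between_corner ds ain bin nab nba ma mb.
have us : uniq (rcons s a) by apply: lin_ordered_uniq.
pose t := [seq x <- rcons s a | x \notin [:: a; b; c]].
have lt : lin_ordered t by apply: subseq_pairwise lin; apply: filter_subseq.
have tP x : x \in t -> [/\ x \in rcons s a, x != a, x != b & x != c].
  by rewrite mem_filter !inE !negb_or => /andP [/and3P []].
have at_ x : x \in t -> ~~ ble a x by case/tP => xs xa _ _; apply: contra xa => /(ma x xs) ->.
have bt_ x : x \in t -> ~~ ble b x by case/tP => xs _ xb _; apply: contra xb => /(mb x xs) ->.
have ct_ x : x \in t -> ~~ ble c x.
  case/tP => xs xa xb xc; apply/negP => /(mc x xs) [] e; move: xa xb xc; rewrite e eqxx //.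
have nac : ~~ ble a c by apply: contra ca => /(ma c cin) ->.
have nbc : ~~ ble b c by apply: contra cb => /(mb c cin) ->.
have L1 : lin_ordered (rcons (t ++ [:: c; b]) a).
  rewrite lin_ordered_rcons all_cat /= nac nab !andbT /lin_ordered pairwise_cat /=.
  rewrite nbc -/(lin_ordered t) lt /= andbT.
  apply/andP; split; first by apply/allP => x /at_.
  by apply/allrelP => x y xt; rewrite !inE => /orP [] /eqP ->; [apply: ct_ | apply: bt_].
have L2 : lin_ordered (rcons (t ++ [:: c; a]) b).
  rewrite lin_ordered_rcons all_cat /= nbc nba !andbT /lin_ordered pairwise_cat /=.
  rewrite nac -/(lin_ordered t) lt /= andbT.
  apply/andP; split; first by apply/allP => x /bt_.
  by apply/allrelP => x y xt; rewrite !inE => /orP [] /eqP ->; [apply: ct_ | apply: at_].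
have p1 : perm_eq (rcons s a) (rcons (t ++ [:: c; b]) a).
  apply: uniq_perm => //; first exact: lin_ordered_uniq.
  move=> x; rewrite [RHS]mem_rcons inE mem_cat mem_filter !inE.
  have [->|xa] /= := eqVneq x a; first by rewrite ain.
  have [->|xb] /= := eqVneq x b; first by rewrite bin !orbT.
  by have [->|xc] /= := eqVneq x c; rewrite ?cin ?orbT ?orbF.
have p2 : perm_eq (rcons (t ++ [:: c; a]) b) (rcons (t ++ [:: c; b]) a).
  by rewrite !rcons_cat perm_cat2l /= perm_cons; apply: (permEl (perm_catC [:: a] [:: b])).
move=> Ps.
have P1 : P (rcons (t ++ [:: c; b]) a ++ u) by apply: same Ps.
have P2 : P (rcons (t ++ [:: c; a]) b ++ u).
  have := HP (size t + 0) _ P1; rewrite !cat_rcons -2!catA dualeq_cat /=.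
  by rewrite between_sym bt.
apply: same P2 => //.
- by have := perm_size p1; rewrite !size_rcons !size_cat /= => -[<-].
- move=> x y; rewrite (perm_mem p2) -(perm_mem p1) => xin yx.
  by rewrite (perm_mem p2) -(perm_mem p1); apply: ds yx.
- by rewrite (perm_trans p2) // (perm_trans _ pe) // perm_sym.
Qed.

End Connected.

(** * The row-by-row word and the comparison of evacuation with rotation *)

Section EvacRotate.
Variables (j k : nat).
Local Notation B := ('I_j * 'I_k)%type.
Local Notation evac := (evac (@far j k)).
Implicit Types (s u v : seq B) (a b c : B).

Lemma size_linext s : linext s -> size s = j * k.
Proof. by case/andP => /eqP. Qed.

Lemma lin_ordered_nth d s i l : lin_ordered s -> i < l -> l < size s ->
  ~~ ble (nth d s l) (nth d s i).
Proof. by move=> /(pairwiseP d) H il ls; apply: H; rewrite ?inE //; lia. Qed.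

Definition row_reading s := forall i, i.+1 < size s -> i.+1 %% k != 0 -> ~~ descent i s.

Lemma descent_nth d i s : i.+1 < size s ->
  descent i s = (content (nth d s i.+1) < content (nth d s i)).
Proof.
move=> lt; have [u [a [b [v [-> <-]]]]] := split_window2 lt.
rewrite -[X in descent X]addn0 descent_cat !nth_cat ltnn subnn subSnn.
by have -> : ((size u).+1 < size u) = false by lia.
Qed.

Definition row_key a := a.1 * k + a.2.

Lemma row_key_inj : injective row_key.
Proof.
move=> [a1 a2] [b1 b2]; rewrite /row_key /= => e.
have k0 : 0 < k by have := ltn_ord a2; lia.
have e1 : a1 = b1 :> nat.
  by have := congr1 (divn^~ k) e; rewrite /= !divnMDl // !divn_small // !addn0.
by congr (_, _); apply: val_inj => //=; move: e; rewrite e1; lia.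
Qed.

(** By strong induction on the position [i], let [z] be the box of key [i], in row [r] and column
    [c], and [x] the box actually read there. Smaller keys are taken and all boxes under [x] have
    been read, so if [x] differs from [z] it must be the first box of row [r.+1], with [c] positive.
    The previous letter is then in row [r], and the step from it to [x] is a descent inside a block
    of length [k]. *)
Lemma row_reading_nth d s : linext s -> row_reading s ->
  forall i, i < size s -> row_key (nth d s i) = i.
Proof.
move=> lx rr i; have [n] := ubnP i; elim: n i => // n IH i lin ls.
have [x ex] : exists x : B, x = nth d s i by exists (nth d s i).
rewrite -ex.
have lins : lin_ordered s by case/andP: lx.
have k0 : 0 < k by have := ltn_ord x.2; lia.
have us := lin_ordered_uniq lins.
have below y : ble y x -> y <> x -> row_key y < i.
  move=> yx nyx; have ys := linext_mem y lx.
  suff yi : index y s < i by have := IH (index y s); rewrite nth_index // => ->; lia.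
  rewrite ltnNge; apply/negP => iy.
  have [e|ne] := eqVneq i (index y s); first by apply: nyx; rewrite ex e nth_index.
  have := @lin_ordered_nth d s i (index y s) lins; rewrite -ex nth_index // index_mem ys yx.
  by move=> H; have := H ltac:(lia) isT.
have above : i <= row_key x.
  rewrite leqNgt; apply/negP => lt.
  have /row_key_inj e : row_key (nth d s (row_key x)) = row_key x by apply: IH; lia.
  have ix : index x s = i by rewrite ex index_uniq.
  by move/(congr1 (index^~ s)): e; rewrite ix index_uniq ?(ltn_trans lt) //; lia.
have := divn_eq i k; have := ltn_pmod i k0; move: (i %/ k) (i %% k) => r c ck ei.
have rj : r < j.
  by have := size_linext lx; have := leq_mul2r k j r; lia.
have xk := ltn_ord x.2; have xj := ltn_ord x.1.
apply: anti_leq; rewrite above andbT leqNgt; apply/negP => lt.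
have [z [z1 z2]] := box_exists rj ck.
have zi : row_key z = i by rewrite /row_key z1 z2 -ei.
have nzx : ~~ (r <= x.1) || ~~ (c <= x.2).
  rewrite -negb_and -z1 -z2; apply/negP => zx.
  have /(below z zx) : z <> x by move=> e; move: lt; rewrite -e zi ltnn.
  by rewrite zi ltnn.
have rx : r < x.1.
  rewrite ltnNge; apply/negP => xr; move: lt nzx; rewrite /row_key => lt.
  have [e|ne] := eqVneq (x.1 : nat) r; first by rewrite e in lt *; lia.
  have H : x.1.+1 * k <= r * k by rewrite leq_mul2r; lia.
  by lia.
have rx1 : x.1 = r.+1 :> nat.
  have [||y [y1 y2]] := @box_exists j k x.1.-1 x.2; [lia|lia|].
  have := below y; rewrite /ble /row_key y1 y2 => H.
  have {}H : x.1.-1 * k + x.2 < i by apply: H; [lia | move=> e; move: y1; rewrite e; lia].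
  apply: anti_leq; rewrite rx andbT leqNgt; apply/negP => xr.
  have H' : r.+1 * k <= x.1.-1 * k by rewrite leq_mul2r; lia.
  by lia.
have x20 : x.2 = 0 :> nat.
  have [||y [y1 y2]] := @box_exists j k x.1 0; [lia|lia|].
  apply/eqP; rewrite -leqn0 leqNgt; apply/negP => x2.
  have := below y; rewrite /ble /row_key y1 y2 => H.
  have {}H : x.1 * k + 0 < i by apply: H; [lia | move=> e; move: y2; rewrite e; lia].
  by rewrite rx1 in H; lia.
have i0 : 0 < i by lia.
have prev : row_key (nth d s i.-1) = i.-1 by apply: IH; lia.
have [w [w1 w2]] := @box_exists j k r c.-1 rj ltac:(lia).
have ew : nth d s i.-1 = w by apply: row_key_inj; rewrite prev /row_key w1 w2; lia.
have := rr i.-1; rewrite prednK // => /(_ ls).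
have -> : i %% k = c by rewrite ei modnMDl modn_small.
rewrite (descent_nth d) prednK // ew -ex.
rewrite /content w1 w2 rx1 x20; lia.
Qed.

Lemma row_reading_uniq s s' :
  linext s -> linext s' -> row_reading s -> row_reading s' -> s = s'.
Proof.
move=> lx lx' rr rr'; have sz : size s = size s' by rewrite !size_linext.
case E: s => [|d t]; first by move: sz; rewrite E => /esym/eqP/nilP.
rewrite -E; apply: (eq_from_nth (x0 := d)) => // i lt.
by apply: row_key_inj; rewrite !row_reading_nth // -sz.
Qed.

Lemma row_reading_exists : exists s, linext s /\ row_reading s.
Proof.
have [e|n0] := posnP (j * k).
  by exists [::]; split=> //; rewrite /linext /= e.
have [j0 k0] : 0 < j /\ 0 < k by apply/andP; rewrite -muln_gt0.
pose f i : B := (insubd (Ordinal j0) (i %/ k), insubd (Ordinal k0) (i %% k)).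
have f1 i : i < j * k -> (f i).1 = i %/ k :> nat.
  by move=> lt; rewrite /= val_insubd ltn_divLR ?lt.
have f2 i : (f i).2 = i %% k :> nat by rewrite /= val_insubd ltn_mod k0.
pose s := mkseq f (j * k); have sz : size s = j * k by rewrite size_mkseq.
have sn i : i < j * k -> nth (f 0) s i = f i by move=> lt; rewrite nth_mkseq.
exists s; split.
  rewrite /linext sz eqxx /=; apply/(pairwiseP (f 0)) => i l; rewrite !inE sz => li ll il.
  rewrite !sn // /ble !f1 // !f2.
  have := divn_eq i k; have := divn_eq l k; have := leq_div2r k (ltnW il).
  move: (i %/ k) (i %% k) (l %/ k) (l %% k) => a b a' b' aa e1 e2.
  by apply/negP => /andP [a1 b1]; have := leq_mul2r k a' a; lia.
move=> i; rewrite sz => li nd; rewrite (descent_nth (f 0)) ?sz // !sn //; last by lia.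
rewrite /content !f1 //; last by lia.
rewrite !f2.
have := divn_eq i k; have := divn_eq i.+1 k; have := ltn_pmod i k0; have := ltn_pmod i.+1 k0.
have := leq_div2r k (leqnSn i); move: nd.
move: (i %/ k) (i %% k) (i.+1 %/ k) (i.+1 %% k) => a b a' b' nb aa b'k bk e' e.
have ea : a = a'.
  apply: anti_leq; rewrite aa /= leqNgt; apply/negP => lt.
  have H : a.+1 * k <= a' * k by rewrite leq_mul2r lt orbT.
  by lia.
by rewrite ea in e *; lia.
Qed.

(* The composite of rotation and evacuation commutes with every dual equivalence
   and preserves descents.  Descents characterise the row-by-row word, which is
   therefore fixed, and every other word is dual equivalent to that one. *)
Lemma evac_rotate s : linext s -> evac (size s).-1 s = rotate s.
Proof.
move=> lx; have [s0 [lx0 rr0]] := row_reading_exists.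
pose P (t : seq B) := linext t /\ rotevac t = t.
have P0 : P (s0 ++ [::]).
  rewrite cats0; split=> //; apply: row_reading_uniq => //; first exact: linext_rotevac.
  move=> i; rewrite /rotevac size_rotate size_evac => lt ik.
  by rewrite descent_rotevac //; apply: rr0.
suff [_ e] : P (s ++ [::]) by rewrite cats0 /rotevac in e; rewrite -[LHS]rotateK e.
apply: (dualeq_connected (P := P) _ _ _ _ _ P0).
- by move=> i t [lt e]; split; [exact: linext_dualeq | rewrite rotevac_dualeq ?e].
- by case/andP: lx0.
- by case/andP: lx.
- by move=> a b _ _; apply: linext_mem.
apply: uniq_perm; [| |by move=> x; rewrite !linext_mem]; apply: lin_ordered_uniq.
- by case/andP: lx0.
- by case/andP: lx.
Qed.

End EvacRotate.

(** * Fixed points of the commuting toggles *)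

Section FixFlips.
Variables (T : Type) (far : rel T).
Hypothesis far_sym : symmetric far.
Local Notation toggle := (toggle far).
Local Notation flips := (flips far).

Lemma drop_toggle n i (s : seq T) : i.+1 < n -> drop n (toggle i s) = drop n s.
Proof.
elim: i n s => [|i IH] [|n] [|a s] //= Hl; last by rewrite IH.
by case: n Hl s => [|n] // _ [|b s] //=; case: ifP.
Qed.

Lemma drop_toggle_id i (s : seq T) : drop i (toggle i s) = toggle 0 (drop i s).
Proof. by elim: i s => [|i IH] [|a s] //=; rewrite ?drop0. Qed.

Lemma drop_flips n m (s : seq T) : m < n -> drop n (flips m s) = drop n s.
Proof.
elim/nat_ind2: m => [//|Hn|m IH Hn]; first exact: drop_toggle.
by rewrite flipsE drop_toggle // IH //; lia.
Qed.

Lemma toggle_fixP i (s : seq T) : i.+1 < size s ->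
  drop i (toggle i s) = drop i s -> toggle i s = s.
Proof.
move=> /split_window2 [u [a [b [v [-> <-]]]]].
by rewrite -[X in toggle X]addn0 toggle_cat !drop_size_cat // => ->.
Qed.

(** The toggles in [flips m] act on disjoint pairs of letters, so the product fixes a word only if
    each factor does. Only the topmost one is visible after dropping the letters before its pair,
    which lets the induction peel it off. *)
Lemma flips_fix m (s : seq T) : m < size s ->
  flips m s = s <-> (forall i, i < m -> odd (m - i) -> toggle i s = s).
Proof.
elim/nat_ind2: m => [|lt|m IH lt].
- by split.
- by split=> [fs [|i] //|]; apply.
have ltm : m < size s by lia.
have top : flips m.+2 s = s -> toggle m.+1 s = s.
  rewrite flipsE => /(congr1 (drop m.+1)); rewrite drop_toggle_id drop_flips // => e.
  by apply: toggle_fixP => //; rewrite drop_toggle_id.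
split=> [fs i|H].
  rewrite ltnS leq_eqVlt => /orP [/eqP -> _|]; first exact: top.
  rewrite ltnS leq_eqVlt => /orP [/eqP ->|im]; first by rewrite (_ : m.+2 - m = 2) //; lia.
  rewrite (_ : m.+2 - i = (m - i).+2); last by lia.
  rewrite /= negbK; move: i im; apply/(IH ltm).
  by move: fs; rewrite flipsE => e; rewrite -[LHS](toggleK far_sym m.+1) e top // flipsE.
rewrite flipsE (IH ltm).2; first by apply: H; rewrite // subSn // subnn.
move=> i im o; apply: H; first by lia.
by rewrite (_ : m.+2 - i = (m - i).+2) /= ?negbK //; lia.
Qed.

End FixFlips.

Section Count.
Variables (j k : nat).
Local Notation B := ('I_j * 'I_k)%type.
Local Notation toggle := (toggle (@far j k)).
Local Notation zig := (zig (@far j k)).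

(** On a linear extension, comparable consecutive boxes form a domino, so this is a chain of shapes
    growing by dominoes. In odd length the last letter is left alone. *)
Fixpoint paired (s : seq B) : bool :=
  if s is [:: a, b & s'] then ble a b && paired s' else true.

Lemma pairedP d (s : seq B) :
  reflect (forall i, i.+1 < size s -> ~~ odd i -> ble (nth d s i) (nth d s i.+1)) (paired s).
Proof.
have [n] := ubnP (size s); elim: n s => // n IH [|a [|b s]] /= sn; try by constructor.
apply: (iffP andP) => [[ab /IH H] [|[|i]] //|H].
  by rewrite /= negbK => lt oi; apply: H => //; lia.
split; first exact: (H 0).
by apply/IH => [|i lt oi]; [lia | apply: (H i.+2); rewrite /= ?negbK].
Qed.

Lemma toggle_fix_ble d i (s : seq B) : linext s -> i.+1 < size s ->
  toggle i s = s <-> ble (nth d s i) (nth d s i.+1).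
Proof.
move=> lx /split_window2 [u [a [b [v [es <-]]]]]; rewrite es in lx *.
have [ab e] := linext_window2 lx.
rewrite !nth_cat ltnn subnn subSnn (_ : (_ < _) = false) /= ?e; last by lia.
rewrite -[X in toggle X]addn0 toggle_cat /=; case: ifP => _; split=> //.
by move/(congr1 (drop (size u))); rewrite !drop_size_cat // => -[e' _]; rewrite e' in ab.
Qed.

Lemma toggles_paired (s : seq B) : linext s ->
  (forall i, i.+1 < size s -> ~~ odd i -> toggle i s = s) <-> paired s.
Proof.
case: s => [|d s] lx; first by split=> // _ [].
split=> [H|/(pairedP d) H i lt oi]; last exact: (toggle_fix_ble d lx lt).2 (H _ lt oi).
by apply/(pairedP d) => i lt oi; apply: (toggle_fix_ble d lx lt).1 (H _ lt oi).
Qed.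

(* When the length is odd, the toggles of [flips] sit at the odd positions; the
   rotation brings them back to the even ones. *)
Definition zigrot (s : seq B) : seq B :=
  if odd (size s) then rotate (zig (size s).-1 s) else zig (size s).-1 s.

Lemma size_zigrot s : size (zigrot s) = size s.
Proof. by rewrite /zigrot; case: ifP; rewrite ?size_rotate size_zig. Qed.

Lemma zigrot_inj s s' : size s = size s' -> zigrot s = zigrot s' -> s = s'.
Proof.
move=> e; rewrite /zigrot e; case: ifP => _.
  by move/(can_inj (@rotateK j k))/(can_inj (zigK (@far_sym j k) _)).
by move/(can_inj (zigK (@far_sym j k) _)).
Qed.

Lemma linext_zigrot s : linext (zigrot s) = linext s.
Proof.
have rot t : linext (rotate t) = linext t.
  by apply/idP/idP => [/linext_rotate|/linext_rotate //]; rewrite rotateK.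
have zigz m t : linext (zig m t) = linext t.
  apply/idP/idP => [/(linext_zag m)|/(linext_zig m) //].
  by rewrite (zigK (@far_sym j k)).
by rewrite /zigrot; case: ifP; rewrite ?rot zigz.
Qed.

Lemma rotate_paired s : linext s -> rotate s = s <-> paired (zigrot s).
Proof.
move=> lx; rewrite -evac_rotate // evac_conj.
set z := zig _ s; have lz : linext z by apply: linext_zig.
have sz : size z = size s by apply: size_zig.
have -> : zag (@far j k) (size s).-1 (flips (@far j k) (size s).-1 z) = s <->
    flips (@far j k) (size s).-1 z = z.
  split=> [e|->]; last by rewrite (zigK (@far_sym j k)).
  by rewrite -[LHS](zagK (@far_sym j k) (size s).-1) e.
have [s0|s0] := posnP (size s).
  have -> : zigrot s = [::] by apply/nilP; rewrite /nilp size_zigrot s0.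
  have -> : z = [::] by apply/nilP; rewrite /nilp sz s0.
  by rewrite s0.
rewrite (flips_fix (@far_sym j k)) ?sz ?prednK //.
rewrite -toggles_paired ?linext_zigrot // size_zigrot.
rewrite /zigrot -/z; case: ifP => os; split=> H i lt oi.
- have lt' : (size s - i.+2).+1 < size z by lia.
  have e : size z - (size s - i.+2).+2 = i by lia.
  have H' : toggle (size s - i.+2) z = z by apply: H; lia.
  by rewrite -{1}e -rotate_toggle // H'.
- have lt' : i.+1 < size z by lia.
  have := H (size z - i.+2); rewrite -rotate_toggle // => H'.
  by apply: (can_inj (@rotateK j k)); apply: H'; lia.
- by apply: H; lia.
- by apply: H; lia.
Qed.

Lemma card_symmetric_paired :
  #|[set t : (j * k).-tuple B | lin_ordered t & rotate t == t]| =
  #|[set t : (j * k).-tuple B | lin_ordered t & paired t]|.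
Proof.
have szt (t : (j * k).-tuple B) : size (zigrot t) == j * k by rewrite size_zigrot size_tuple.
pose h t := Tuple (szt t).
have hinj : injective h.
  move=> t t' /(congr1 val) /= /zigrot_inj e; apply: val_inj.
  by apply: e; rewrite !size_tuple.
have hbij : bijective h by apply: injF_bij.
have lxE (t : (j * k).-tuple B) : lin_ordered t = linext t by rewrite /linext size_tuple eqxx.
rewrite -[RHS](on_card_preimset (f := h)); last exact: onW_bij.
apply: eq_card => t; rewrite !inE !lxE /= linext_zigrot.
have [lx|//] := boolP (linext t).
by apply/eqP/idP => /(rotate_paired lx).
Qed.

End Count.

(** * Words of dominoes and domino tableaux *)

Section Dominoes.
Variables (j k : nat).
Hypotheses (hj : 0 < j) (hk : 0 < k).
Local Notation B := ('I_j * 'I_k)%type.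
Local Notation la := (near_rectangle j k).
Local Notation N := (j * k).

Lemma size_near_rectangle : size la = j.
Proof. by rewrite /near_rectangle; case: ifP => _; rewrite ?size_rcons size_nseq ?prednK. Qed.

Lemma sumn_near_rectangle : sumn la = N - odd N.
Proof.
rewrite /near_rectangle [k * j]mulnC; case: ifP => o; last by rewrite sumn_nseq mulnC subn0.
by rewrite sumn_rcons sumn_nseq -{2}(prednK hj) mulSn [k * _]mulnC; lia.
Qed.

Lemma nth_near_rectangle r : r < j -> nth 0 la r = k - (odd N && (r == j.-1)).
Proof.
move=> rj; rewrite /near_rectangle [k * j]mulnC; case: ifP => o /=.
  rewrite nth_rcons size_nseq nth_nseq; case: ltngtP => //; lia.
by rewrite nth_nseq rj subn0.
Qed.

Lemma row_lt (x : box la) : box_row x < j.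
Proof. by rewrite -{2}size_near_rectangle; apply: ltn_ord. Qed.

Lemma col_lt (x : box la) : box_col x < k - (odd N && (box_row x == j.-1)).
Proof. by rewrite -nth_near_rectangle ?row_lt //; apply: ltn_ord. Qed.

Lemma col_ltk (x : box la) : box_col x < k.
Proof. by have := col_lt x; lia. Qed.

Definition emb (x : box la) : B := (Ordinal (row_lt x), Ordinal (col_ltk x)).

Lemma emb_inj : injective emb.
Proof.
move=> [[r hr] [c hc]] [[r' hr'] [c' hc']] [] /= e1 e2.
move: e1 e2; rewrite /box_row /box_col /= => e1 e2; subst r' c'.
by rewrite (bool_irrelevance hr hr') in hc hc' *; rewrite (bool_irrelevance hc hc').
Qed.

Definition corner (b : B) := (b.1 == j.-1 :> nat) && (b.2 == k.-1 :> nat).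

Lemma emb_corner x : odd N -> ~~ corner (emb x).
Proof. by move=> o; have := col_lt x; rewrite o /corner /=; lia. Qed.

Lemma emb_surj b : ~~ (odd N && corner b) -> exists x, emb x = b.
Proof.
move=> nc; have rj : b.1 < size la by rewrite size_near_rectangle.
have ck : b.2 < nth 0 la b.1.
  by rewrite nth_near_rectangle //; move: nc (ltn_ord b.2); rewrite /corner; lia.
exists (existT _ (Ordinal rj) (Ordinal ck)).
by case: b rj ck {nc} => b1 b2 rj ck; rewrite /emb; congr (_, _); apply: val_inj.
Qed.

Lemma corner_ble a b : corner a -> ble b a.
Proof. by rewrite /corner /ble; have := ltn_ord b.1; have := ltn_ord b.2; lia. Qed.

Lemma linext_cover u (a b : B) v : linext (u ++ [:: a, b & v]) -> ble a b ->
  a.1 = b.1 /\ b.2 = a.2.+1 :> nat \/ a.2 = b.2 /\ b.1 = a.1.+1 :> nat.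
Proof.
move=> lx; have [_ cv] := @linext_window _ _ u [:: a; b] v lx.
move=> ab; have [nab _] := linext_window2 lx.
have step z : ble a z -> ble z b -> z != a -> z = b.
  move=> az zb za; have := cv a b z; rewrite !inE !eqxx orbT => /(_ isT isT az zb).
  by rewrite (negbTE za) => /eqP.
have [lt|ge] := ltnP a.1 b.1.
  have [||z [z1 z2]] := @box_exists j k a.1.+1 a.2; [by have := ltn_ord b.1; lia|by []|].
  right; have e : z = b.
    apply: step; rewrite ?/ble ?z1 ?z2; [lia | move: ab; rewrite /ble; lia |].
    by apply/eqP => e; move: z1; rewrite e; lia.
  by rewrite -e; split=> //; apply: val_inj.
have e1 : a.1 = b.1 by apply: val_inj; move: ab; rewrite /= /ble; lia.
have lt2 : a.2 < b.2.
  rewrite ltnNge; apply/negP => le; apply: nab; congr content.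
  by apply: ble_anti => //; rewrite /ble -e1 leqnn.
have [||z [z1 z2]] := @box_exists j k a.1 a.2.+1; [by []|by have := ltn_ord b.2; lia|].
left; have e : z = b.
  apply: step; rewrite ?/ble ?z1 ?z2; [lia | move: ab; rewrite /ble; lia |].
  by apply/eqP => e; move: z2; rewrite e; lia.
by split=> //; rewrite -e z2.
Qed.

(** Supplies the default label in [labelling]. The number of labels vanishes only for [j = k = 1],
    where the shape has no box [x]. *)
Lemma label_bound (x : box la) : 0 < (sumn la)./2.
Proof.
have := @emb_corner x; rewrite sumn_near_rectangle /corner /=.
have := row_lt x; have := col_ltk x; move: (box_row x) (box_col x) => r c ck rj H.
have [N1|] := leqP N 1; last by lia.
have [j1 k1] : j = 1 /\ k = 1.
  split; apply/eqP; rewrite eqn_leq ?hj ?hk andbT (leq_trans _ N1) //;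
    by rewrite (leq_pmulr, leq_pmull).
by move: H; rewrite j1 k1 => /(_ isT); lia.
Qed.

Definition labelling (s : seq B) : {ffun box la -> 'I_((sumn la)./2)} :=
  [ffun x => insubd (Ordinal (label_bound x)) (index (emb x) s)./2].

(** The corner lies above every box, so it is read last. For odd [N] the letter left alone by
    [paired] is thus exactly the box missing from the shape. *)
Lemma linext_corner (d : B) s : linext s -> corner (nth d s (size s).-1) || (size s == 0).
Proof.
move=> lx; have [->|s0] := posnP (size s); first by rewrite orbT.
apply/orP; left.
have [c [c1 c2]] := @box_exists j k j.-1 k.-1 ltac:(lia) ltac:(lia).
have cc : corner c by rewrite /corner c1 c2 !eqxx.
have cs := linext_mem c lx.
suff -> : (size s).-1 = index c s by rewrite nth_index.
have := cs; rewrite -index_mem => ic.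
have ic' : index c s <= (size s).-1 by rewrite -ltnS prednK.
apply: anti_leq; rewrite ic' andbT.
rewrite leqNgt; apply/negP => lt.
have lins : lin_ordered s by case/andP: lx.
have := lin_ordered_nth d lins lt; rewrite prednK // => /(_ (leqnn _)).
by rewrite nth_index // (corner_ble _ cc).
Qed.

Section Word.
Variables (s : seq B) (d : B).
Hypotheses (lx : linext s) (ps : paired s).

Let us : uniq s. Proof. by apply: lin_ordered_uniq; case/andP: lx. Qed.

Lemma index_ble a b : ble a b -> index a s <= index b s.
Proof.
move=> ab; rewrite leqNgt; apply/negP => lt.
have lins : lin_ordered s by case/andP: lx.
have := lin_ordered_nth d lins lt; rewrite index_mem !nth_index ?linext_mem // => /(_ isT).
by rewrite ab.
Qed.

Lemma index_emb x : (index (emb x) s)./2 < (sumn la)./2.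
Proof.
rewrite sumn_near_rectangle.
have := linext_mem (emb x) lx; rewrite -index_mem (size_linext lx) => lt.
have [o|] := boolP (odd N); last by lia.
suff : index (emb x) s != N.-1 by lia.
apply/eqP => e; have := linext_corner d lx.
rewrite (size_linext lx) -e nth_index ?linext_mem //.
by rewrite (negbTE (emb_corner _ o)); lia.
Qed.

Lemma labellingE x : labelling s x = (index (emb x) s)./2 :> nat.
Proof. by rewrite ffunE val_insubd index_emb. Qed.

Lemma labelling_ble x y : ble (emb x) (emb y) -> labelling s x <= labelling s y.
Proof. by move=> /index_ble le; rewrite !labellingE half_leq. Qed.

Lemma index_half i b : i.+1 < size s -> ~~ odd i ->
  ((index b s)./2 == i./2) = (b == nth d s i) || (b == nth d s i.+1).
Proof.
move=> lt oi; have := linext_mem b lx => bs; have ib := nth_index d bs.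
rewrite -{2 3}ib !nth_uniq ?index_mem ?(ltnW lt) //.
by move: (index b s) oi => m; lia.
Qed.

Lemma labelling_tableau : labelling s \in domino_tableaux la.
Proof.
rewrite inE; apply/and3P; split.
- apply/forallP => l; have := ltn_ord l; rewrite {2}sumn_near_rectangle => ll.
  have lt : l.*2.+1 < size s by rewrite (size_linext lx); lia.
  have ol : ~~ odd l.*2 by lia.
  have nc i : i < l.*2.+2 -> ~~ (odd N && corner (nth d s i)).
    move=> il; apply/negP => /andP [o c].
    have := index_ble (corner_ble (nth d s (size s).-1) c).
    rewrite !index_uniq //; rewrite (size_linext lx); lia.
  have [x ex] := emb_surj (nc l.*2 ltac:(lia)).
  have [y ey] := emb_surj (nc l.*2.+1 ltac:(lia)).
  apply/existsP; exists x; apply/existsP; exists y; apply/andP; split.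
    have ab : ble (emb x) (emb y) by rewrite ex ey; apply: (pairedP d).
    have [u [a [b [v [es su]]]]] := split_window2 lt.
    have := @linext_cover u a b v; rewrite -es => /(_ lx).
    have ea : emb x = a by rewrite ex es nth_cat su ltnn subnn.
    have eb : emb y = b by rewrite ey es nth_cat su ltnNge leqnSn subSnn.
    rewrite -ea -eb => /(_ ab) [[/(congr1 val) e1 e2]|[/(congr1 val) e1 e2]];
      by move: e1 e2; rewrite /edge_adjacent /=; lia.
  apply/eqP/setP => z; rewrite !inE -val_eqE /= labellingE.
  by rewrite -[X in _ == X](doubleK l) index_half // -ex -ey !(inj_eq emb_inj).
- apply/forallP => x; apply/forallP => y; apply/implyP => /andP [/eqP r c].
  by apply: labelling_ble; rewrite /ble /= r leqnn ltnW.
- apply/forallP => x; apply/forallP => y; apply/implyP => /andP [/eqP r c].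
  by apply: labelling_ble; rewrite /ble /= r leqnn ltnW.
Qed.

End Word.

(** The labels give the unordered pair of boxes at positions [i] and [i.+1] for even [i], and
    [paired] orders it. A last unpaired letter is the corner in both words. *)
Lemma labelling_inj (s s' : seq B) : linext s -> linext s' -> paired s -> paired s' ->
  labelling s = labelling s' -> s = s'.
Proof.
move=> lx lx' ps ps' e.
have sz : size s = size s' by rewrite !size_linext.
case E: s => [|d t]; first by move: sz; rewrite E => /esym/eqP/nilP.
rewrite -E; have us' := lin_ordered_uniq (proj2 (andP lx')).
have us := lin_ordered_uniq (proj2 (andP lx)).
have half x : (index (emb x) s)./2 = (index (emb x) s')./2.
  by rewrite -(labellingE d lx ps x) e (labellingE d lx' ps' x).
have N0 : 0 < N by rewrite muln_gt0 hj hk.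
have cor b : odd N && corner b -> forall r, linext r -> index b r = N.-1.
  move=> /andP [o cb] r lr; have := linext_corner d lr; rewrite (size_linext lr).
  rewrite eqn0Ngt N0 orbF => cn.
  have -> : b = nth d r N.-1 by apply: ble_anti; exact: corner_ble.
  by rewrite index_uniq ?(size_linext lr) ?prednK //; apply: lin_ordered_uniq; case/andP: lr.
have nc i : i.+1 < size s -> ~~ odd i ->
    (nth d s i == nth d s' i) && (nth d s i.+1 == nth d s' i.+1).
  move=> lt oi; have lt' : i.+1 < size s' by rewrite -sz.
  have H b : (b == nth d s i) || (b == nth d s i.+1) =
      (b == nth d s' i) || (b == nth d s' i.+1).
    rewrite -!index_half //; have [nb|/negbNE cb] := boolP (~~ (odd N && corner b)).
      by have [x <-] := emb_surj nb; rewrite half.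
    by rewrite !cor.
  have ab := (pairedP d _ ps) i lt oi; have ab' := (pairedP d _ ps') i lt' oi.
  have := H (nth d s i); have := H (nth d s i.+1); rewrite !eqxx ?orbT /=.
  have nab : nth d s i != nth d s i.+1 by rewrite nth_uniq ?(ltnW lt) //; lia.
  move=> /esym/orP [] /eqP e2 /esym/orP [] /eqP e1.
  - by move: nab; rewrite e1 e2 eqxx.
  - rewrite e1 e2 in ab nab *; have := ble_anti ab ab'; move/eqP => f.
    by rewrite f in nab.
  - by rewrite e1 e2 !eqxx.
  - by move: nab; rewrite e1 e2 eqxx.
apply: (eq_from_nth (x0 := d)) => // i lt.
have [o|o] := boolP (odd i).
  case: i o lt => // i /= o lt; by have /andP [_ /eqP] := nc i lt o.
have [lt'|ge] := ltnP i.+1 (size s); first by have /andP [/eqP] := nc i lt' o.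
have en : i = (size s).-1 by lia.
have s0 : (size s == 0) = false by rewrite eqn0Ngt (leq_ltn_trans _ lt).
have c1 := linext_corner d lx; have c2 := linext_corner d lx'.
rewrite en; apply: ble_anti; apply: corner_ble.
  by move: c2; rewrite -sz s0 orbF.
by move: c1; rewrite s0 orbF.
Qed.

Section Tableau.
Variable T : {ffun box la -> 'I_((sumn la)./2)}.
Hypothesis hT : T \in domino_tableaux la.

Lemma tableau_domino x y : T x = T y -> x <> y ->
  (forall z, T z = T x -> z = x \/ z = y) /\ edge_adjacent x y.
Proof.
move: hT; rewrite inE => /andP [/forallP /(_ (T x)) /existsP [p] + _].
case/existsP => q /andP [adj /eqP cl].
move=> e nxy; have inc z : (T z == T x) = (z == p) || (z == q).
  by move/setP: cl => /(_ z); rewrite !inE.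
have adj' : edge_adjacent q p by move: adj; rewrite /edge_adjacent; lia.
have := inc x; have := inc y; rewrite e !eqxx => /esym/orP [] /eqP ey /esym/orP [] /eqP ex.
- by case: nxy; rewrite ex ey.
- by split; [move=> z /eqP; rewrite -e inc ex ey => /orP [] /eqP; auto | rewrite ex ey].
- by split; [move=> z /eqP; rewrite -e inc ex ey => /orP [] /eqP; auto | rewrite ex ey].
- by case: nxy; rewrite ex ey.
Qed.

Lemma tableau_mono x y : ble (emb x) (emb y) -> T x <= T y.
Proof.
move=> /andP [/= rxy cxy]; move: hT; rewrite inE => /and3P [_ /forallP hr /forallP hc].
(* The path from [x] to [y] turns at the box in the row of [x] and the column of [y]; it cannot be
   the missing corner, for then [y] would be that corner too. *)
have [|z ez] := @emb_surj ((emb x).1, (emb y).2).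
  apply/negP => /andP [o c]; have := emb_corner y o; move: c.
  by rewrite /corner /=; have := row_lt y; lia.
have zr : box_row z = box_row x by have /(congr1 (fun b : B => val b.1)) := ez.
have zc : box_col z = box_col y by have /(congr1 (fun b : B => val b.2)) := ez.
apply: (@leq_trans (T z)).
  move: cxy; rewrite leq_eqVlt => /orP [/eqP c|c].
    suff -> : z = x by [].
    by apply: emb_inj; congr (_, _); apply: val_inj; rewrite /= ?zr ?zc.
  by have /forallP/(_ z)/implyP := hr x; apply; rewrite zr zc eqxx.
move: rxy; rewrite leq_eqVlt => /orP [/eqP c|c].
  suff -> : z = y by [].
  by apply: emb_inj; congr (_, _); apply: val_inj; rewrite /= ?zr ?zc.
by have /forallP/(_ y)/implyP := hc z; apply; rewrite zr zc eqxx.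
Qed.

(* [x] is the box of its domino farther from the origin. *)
Definition second x := [exists y, [&& T y == T x, y != x & ble (emb y) (emb x)]].

(* The position of [b] in the word to be built; the missing corner of the
   near-rectangle, when there is one, comes last. *)
Definition key (b : B) : nat :=
  if [pick x | emb x == b] is Some x then (T x).*2 + second x else N.-1.

Lemma key_emb x : key (emb x) = (T x).*2 + second x.
Proof.
rewrite /key; case: pickP => [y /eqP /emb_inj -> //|/(_ x)].
by rewrite eqxx.
Qed.

Lemma boxP b : (exists x, emb x = b) \/ [/\ odd N, corner b & key b = N.-1].
Proof.
have [/emb_surj|/negbNE /andP [o c]] := boolP (~~ (odd N && corner b)); first by left.
right; split=> //; rewrite /key; case: pickP => // x /eqP e.
by have := emb_corner x o; rewrite e c.
Qed.

Lemma second_lt x y : T x = T y -> x <> y -> ble (emb x) (emb y) ->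
  second x = false /\ second y.
Proof.
move=> e n xy; split; last first.
  by apply/existsP; exists x; rewrite e eqxx xy andbT; apply/eqP.
apply/negbTE/existsP => -[z /and3P [/eqP ez /eqP nz zx]].
have [/(_ z ez) [//|ezy] _] := tableau_domino e n.
by rewrite ezy in zx; apply/n/emb_inj/ble_anti.
Qed.

Lemma key_bound x : key (emb x) < N - odd N.
Proof. by have := ltn_ord (T x); have := sumn_near_rectangle; rewrite key_emb; lia. Qed.

Lemma key_mono a b : ble a b -> a <> b -> key a < key b.
Proof.
move=> ab nab.
have [[x ex]|[o ca _]] := boxP a; last first.
  by case: nab; apply: ble_anti; rewrite ?(corner_ble _ ca).
have [[y ey]|[o cb ->]] := boxP b; last first.
  by rewrite -ex; have := key_bound x; rewrite o; lia.
rewrite -ex -ey in ab nab *; rewrite !key_emb.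
have nxy : x <> y by move=> e; rewrite e in nab.
have := tableau_mono ab; rewrite leq_eqVlt => /orP [/eqP/val_inj e|lt].
  by have [-> ->] := second_lt e nxy ab; rewrite e; lia.
by case: (second x); case: (second y); lia.
Qed.

Lemma key_inj : injective key.
Proof.
move=> a b; have [[x <-]|[o ca ea]] := boxP a; have [[y <-]|[o' cb eb]] := boxP b.
- rewrite !key_emb => e; have e1 : T x = T y by apply: val_inj => /=; lia.
  congr emb; apply/eqP/negPn/negP => /eqP nxy.
  have [_ adj] := tableau_domino e1 nxy.
  have : ble (emb x) (emb y) || ble (emb y) (emb x).
    by move: adj; rewrite /edge_adjacent /ble /=; lia.
  case/orP => le.
    by have [sx sy] := second_lt e1 nxy le; move: e; rewrite e1 sx sy; lia.
  have nyx : y <> x by move=> eyx; case: nxy.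
  by have [sx sy] := second_lt (esym e1) nyx le; move: e; rewrite e1 sx sy; lia.
- by have := key_bound x; rewrite o' eb; lia.
- by have := key_bound y; rewrite o ea; lia.
- by move=> _; apply: ble_anti; apply: corner_ble.
Qed.

Lemma key_lt b : key b < N.
Proof.
have N0 : 0 < N by rewrite muln_gt0 hj hk.
by have [[x <-]|[_ _ ->]] := boxP b; [have := key_bound x|]; lia.
Qed.

(** [key] injects the boxes into equally many positions, so it has an inverse, which is the word
    sought. [key_mono] makes it a linear extension, and the two boxes of a domino have consecutive
    keys. *)
Lemma labelling_surj :
  exists t : N.-tuple B, [/\ lin_ordered t, paired t & labelling t = T].
Proof.
pose K b := Ordinal (key_lt b).
have Kinj : injective K by move=> a b /(congr1 val) /key_inj.
have [g Kg gK] : bijective K by apply: inj_card_bij => //; rewrite card_prod !card_ord.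
pose t := mktuple g; exists t.
have d : B := (Ordinal hj, Ordinal hk).
have tn i (lt : i < N) : nth d t i = g (Ordinal lt).
  by rewrite -[i]/(val (Ordinal lt)) -tnth_nth tnth_mktuple.
have keyn i : i < N -> key (nth d t i) = i.
  by move=> lt; rewrite tn -[key _]/(val (K _)) gK.
have lt_ : lin_ordered t.
  apply/(pairwiseP d) => i l; rewrite !inE size_tuple => iN lN il.
  apply/negP => le; have : nth d t l <> nth d t i.
    by move/(congr1 key); rewrite !keyn //; lia.
  by move/(key_mono le); rewrite !keyn //; lia.
have lx : linext t by rewrite /linext size_tuple eqxx.
have pt : paired t.
  apply/(pairedP d) => i; rewrite size_tuple => lt oi.
  have [[x ex]|[o c]] := boxP (nth d t i); last by rewrite keyn //; lia.
  have [[y ey]|[o c]] := boxP (nth d t i.+1); last by rewrite keyn //; lia.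
  have kx : key (emb x) = i by rewrite ex keyn //; lia.
  have ky : key (emb y) = i.+1 by rewrite ey keyn.
  have nxy : x <> y by move=> e; move: kx; rewrite e ky; lia.
  rewrite !key_emb in kx ky; rewrite -ex -ey.
  have e1 : T x = T y by apply: val_inj => /=; lia.
  have : second y by lia.
  case/existsP => z /and3P [/eqP ez /eqP nz zy].
  have [/(_ z) H _] := tableau_domino e1 nxy.
  by case: H => [|ezx|//]; [rewrite ez | rewrite ezx in zy].
split=> //; apply/ffunP => x; apply: val_inj; rewrite /= (labellingE d) //.
have -> : index (emb x) t = key (emb x).
  have kN := key_lt (emb x).
  have -> : emb x = nth d t (key (emb x)) by apply: key_inj; rewrite keyn.
  by rewrite index_uniq ?size_tuple ?keyn //; apply: lin_ordered_uniq.
by rewrite key_emb; case: (second x); rewrite ?addn1 ?addn0 /= ?uphalf_double ?doubleK.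
Qed.
End Tableau.

Lemma card_paired_domino :
  #|[set t : N.-tuple B | lin_ordered t & paired t]| = #|domino_tableaux la|.
Proof.
have d : B := (Ordinal hj, Ordinal hk).
have lxE (t : N.-tuple B) : lin_ordered t -> linext t by rewrite /linext size_tuple eqxx.
rewrite -(card_in_imset (f := fun t : N.-tuple B => labelling t)).
  apply: eq_card => T; apply/imsetP/idP => [[t] | hT].
    by rewrite inE => /andP [/lxE lx pt] ->; apply: labelling_tableau.
  have [t [lt pt e]] := labelling_surj hT.
  by exists t; rewrite ?inE ?lt ?pt.
move=> t t'; rewrite !inE => /andP [/lxE lx pt] /andP [/lxE lx' pt'] e.
by apply: val_inj; apply: labelling_inj e.
Qed.

End Dominoes.

(** * Extremal Erdos-Szekeres permutations *)

Section Chains.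
Variable N : nat.
Implicit Types (s : {perm 'I_N}) (A : {set 'I_N}) (b : bool).

(* The permutation is increasing on [A] for [b = false], decreasing for [b = true]. *)
Definition chain b s A :=
  [forall x in A, forall y in A, (x < y) ==> ((s x < s y) (+) b)].
Definition central s := [forall i, s (rev_ord i) == rev_ord (s i)].
Definition avoids b m s := [forall A : {set 'I_N}, chain b s A ==> (#|A| <= m)].

Lemma chainP b s A :
  reflect (forall x y : 'I_N, x \in A -> y \in A -> x < y -> (s x < s y) (+) b) (chain b s A).
Proof.
apply: (iffP forall_inP) => [H x y xA yA xy|H x xA].
  by have /forall_inP/(_ y yA)/implyP := H x xA; apply.
by apply/forall_inP => y yA; apply/implyP; apply: H.
Qed.

Lemma avoidsP b m s :
  reflect (forall A : {set 'I_N}, chain b s A -> #|A| <= m) (avoids b m s).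
Proof. by apply: (iffP forallP) => H A; apply/implyP/(H A). Qed.

Definition ends_at (i : 'I_N) A := (i \in A) && [forall x in A, x <= i].

Lemma ends_atP i A : reflect (i \in A /\ forall x : 'I_N, x \in A -> x <= i) (ends_at i A).
Proof. by apply: (iffP andP) => -[iA /forall_inP]. Qed.

Definition len b s i := \max_(A : {set 'I_N} | chain b s A && ends_at i A) #|A|.

Lemma len_gt0 b s i : 0 < len b s i.
Proof.
rewrite -(cards1 i); apply: (leq_bigmax_cond (F := fun A : {set 'I_N} => #|A|)).
apply/andP; split; first by apply/chainP => x y /set1P -> /set1P ->; rewrite ltnn.
by apply/ends_atP; split=> [|x /set1P ->]; rewrite ?set11.
Qed.

Lemma len_ltn b s (i l : 'I_N) : i < l -> (s i < s l) (+) b -> len b s i < len b s l.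
Proof.
move=> il sil.
have cnd : 0 < #|[pred A | chain b s A && ends_at i A]|.
  apply/card_gt0P; exists [set i]; rewrite inE; apply/andP; split.
    by apply/chainP => x y /set1P -> /set1P ->; rewrite ltnn.
  by apply/ends_atP; split=> [|x /set1P ->]; rewrite ?set11.
have [A] := eq_bigmax_cond (fun A : {set 'I_N} => #|A|) cnd.
rewrite inE => /andP [/chainP cA /ends_atP [iA Ai]] e.
have lA : l \notin A by apply/negP => /Ai; rewrite leqNgt il.
rewrite /len {}e (_ : #|A|.+1 = #|l |: A|); last by rewrite cardsU1 lA.
apply: (leq_bigmax_cond (F := fun A : {set 'I_N} => #|A|)); apply/andP; split.
  apply/chainP => x y; rewrite !inE => /orP [/eqP ->|xA] /orP [/eqP ->|yA] xy.
  - by rewrite ltnn in xy.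
  - by have := Ai y yA; lia.
  - have [->//|xi] := eqVneq x i.
    have lt : x < i by rewrite ltn_neqAle val_eqE xi Ai.
    by have := cA x i xA iA lt; move: sil; clear; case: b => /=; lia.
  - exact: cA.
apply/ends_atP; split=> [|x]; first by rewrite setU11.
by rewrite !inE => /orP [/eqP -> //|/Ai xi]; exact: leq_trans xi (ltnW il).
Qed.

Lemma len_avoids b m s i : avoids b m s -> len b s i <= m.
Proof. by move=> /avoidsP av; apply/bigmax_leqP => A /andP [/av]. Qed.

Lemma card_leq_inj (A : {set 'I_N}) (f : 'I_N -> nat) m :
  {in A &, injective f} -> (forall x, x \in A -> f x < m) -> #|A| <= m.
Proof.
move=> fi fm; rewrite cardE -(size_map f) -(size_iota 0 m); apply: uniq_leq_size.
  rewrite map_inj_in_uniq ?enum_uniq // => x y; rewrite !mem_enum; exact: fi.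
by move=> y /mapP [x]; rewrite mem_enum => /fm xm ->; rewrite mem_iota.
Qed.

Lemma perm_ltn_total s (i l : 'I_N) : i < l -> (s i < s l) || (s l < s i).
Proof.
move=> il; rewrite -neq_ltn val_eqE (inj_eq perm_inj) -val_eqE /=; lia.
Qed.

End Chains.

(* Erdos-Szekeres: [i] goes to the lengths, minus one, of the longest
   decreasing and increasing subsequences ending at [i]. *)
Section ESBox.
Variables (j k N : nat) (s : {perm 'I_N}).
Hypotheses (hinc : avoids false k s) (hdec : avoids true j s).

Lemma len_pred_lt b m i : avoids b m s -> (len b s i).-1 < m.
Proof. by move=> /(@len_avoids _ _ _ _ i); have := len_gt0 b s i; lia. Qed.

Definition esbox i : 'I_j * 'I_k :=
  (Ordinal (len_pred_lt i hdec), Ordinal (len_pred_lt i hinc)).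

Lemma esbox1 (i l : 'I_N) : i < l -> s l < s i -> (esbox i).1 < (esbox l).1.
Proof.
move=> il sli; have := @len_ltn _ true s i l il; rewrite addbT -leqNgt ltnW // => /(_ isT).
by have := len_gt0 true s i; rewrite /=; lia.
Qed.

Lemma esbox2 (i l : 'I_N) : i < l -> s i < s l -> (esbox i).2 < (esbox l).2.
Proof.
move=> il sli; have := @len_ltn _ false s i l il; rewrite addbF sli => /(_ isT).
by have := len_gt0 false s i; rewrite /=; lia.
Qed.

Lemma esbox_inj : injective esbox.
Proof.
suff H (i l : 'I_N) : i < l -> esbox i <> esbox l.
  move=> i l e; apply: val_inj; case: (ltngtP i l) => // lt; first by case: (H _ _ lt).
  by case: (H _ _ lt).
move=> il e; case/orP: (perm_ltn_total s il) => lt.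
  by have := esbox2 il lt; rewrite e ltnn.
by have := esbox1 il lt; rewrite e ltnn.
Qed.

Lemma erdos_szekeres : N <= j * k.
Proof. by have := leq_card esbox esbox_inj; rewrite card_prod !card_ord. Qed.
End ESBox.

Section Bijection.
Variables (j k : nat).
Local Notation B := ('I_j * 'I_k)%type.
Local Notation N := (j * k).
Implicit Types (s : {perm 'I_N}) (P Q : N.-tuple B).

(** When points are read by increasing value, of two points the later one has the larger column if
    its position is larger, and the smaller row otherwise. Reversing the rows turns this into the
    condition for a linear extension. *)
Definition flipbox (a : B) : B := (rev_ord a.1, a.2).

Lemma flipboxK : involutive flipbox.
Proof. by case=> a1 a2; rewrite /flipbox /= rev_ordK. Qed.

Lemma flipbox_ble (a b : B) : ble (flipbox a) (flipbox b) = (b.1 <= a.1) && (a.2 <= b.2).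
Proof. by rewrite /ble /=; have := ltn_ord a.1; have := ltn_ord b.1; lia. Qed.

(* Two tableaux, as words [P] and [Q], determine the permutation sending the
   label in [P] of each box to the label in [Q] of its image under [flipbox]. *)
Definition matches s P Q := forall i, flipbox (tnth P i) = tnth Q (s i).

Lemma lin_ordered_tnth P (i l : 'I_N) : lin_ordered P -> i < l -> ~~ ble (tnth P l) (tnth P i).
Proof.
(* An opaque default: with [tnth P i] itself, rewriting by [tnth_nth] would loop. *)
move=> lin il; have [d _] : exists d : B, d = d by exists (tnth P i).
rewrite !(tnth_nth d).
by apply: lin_ordered_nth => //; rewrite size_tuple.
Qed.

Lemma tnth_inj P : lin_ordered P -> injective (tnth P).
Proof.
move=> lin i l e; apply: val_inj.
by case: (ltngtP i l) => // lt; have := lin_ordered_tnth lin lt; rewrite e ble_refl.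
Qed.

Lemma lin_ordered_tupleP P :
  (forall i l : 'I_N, i < l -> ~~ ble (tnth P l) (tnth P i)) -> lin_ordered P.
Proof.
move=> H; have [d _|n0] := pickP 'I_N; last first.
  have [N0|N0] := posnP N; last by have := n0 (Ordinal N0).
  by have -> : P = [::] :> seq B by apply/nilP; rewrite /nilp size_tuple N0.
have [d0 _] : exists d0 : B, d0 = d0 by exists (tnth P d).
apply/(pairwiseP d0) => i l; rewrite !inE size_tuple => iN lN il.
by have := H (Ordinal iN) (Ordinal lN) il; rewrite !(tnth_nth d0).
Qed.

Section Matching.
Variables (s : {perm 'I_N}) (P Q : N.-tuple B).
Hypotheses (lP : lin_ordered P) (lQ : lin_ordered Q) (sPQ : matches s P Q).

(** If the column did not grow, [P] would force the row to grow, while [Q], through the flip, would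
    force it to shrink. *)
Lemma matches_col (i l : 'I_N) : i < l -> s i < s l -> (tnth P i).2 < (tnth P l).2.
Proof.
move=> il sil; have := lin_ordered_tnth lP il; have := lin_ordered_tnth lQ sil.
rewrite -!sPQ flipbox_ble /ble.
by move: (tnth P i) (tnth P l) => a b; lia.
Qed.

Lemma matches_row (i l : 'I_N) : i < l -> s l < s i -> (tnth P i).1 < (tnth P l).1.
Proof.
move=> il sil; have := lin_ordered_tnth lP il; have := lin_ordered_tnth lQ sil.
rewrite -!sPQ flipbox_ble /ble.
by move: (tnth P i) (tnth P l) => a b; lia.
Qed.

Lemma chain_lt_col A (i l : 'I_N) : chain false s A -> i \in A -> l \in A -> i < l ->
  (tnth P i).2 < (tnth P l).2.
Proof.
move=> /chainP cA iA lA il; apply: matches_col => //.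
by have := cA i l iA lA il; rewrite addbF.
Qed.

Lemma chain_lt_row A (i l : 'I_N) : chain true s A -> i \in A -> l \in A -> i < l ->
  (tnth P i).1 < (tnth P l).1.
Proof.
move=> /chainP cA iA lA il; apply: matches_row => //; have := cA i l iA lA il.
by rewrite addbT => /negbTE h; have := perm_ltn_total s il; rewrite h.
Qed.

Lemma ltn_inj_in (A : {set 'I_N}) (f : 'I_N -> nat) :
  (forall i l : 'I_N, i \in A -> l \in A -> i < l -> f i < f l) -> {in A &, injective f}.
Proof.
move=> H i l iA lA e; apply: val_inj.
case: (ltngtP i l) => // lt; [have := H i l iA lA lt | have := H l i lA iA lt];
  by rewrite e ltnn.
Qed.

Lemma matches_avoids_inc : avoids false k s.
Proof.
apply/avoidsP => A cA.
apply: (card_leq_inj (f := fun i => (tnth P i).2)) => [|x _]; last exact: ltn_ord.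
by apply: ltn_inj_in => i l; apply: chain_lt_col.
Qed.

Lemma matches_avoids_dec : avoids true j s.
Proof.
apply/avoidsP => A cA.
apply: (card_leq_inj (f := fun i => (tnth P i).1)) => [|x _]; last exact: ltn_ord.
by apply: ltn_inj_in => i l; apply: chain_lt_row.
Qed.

Lemma len_inc_leq i : len false s i <= (tnth P i).2.+1.
Proof.
apply/bigmax_leqP => A /andP [cA /ends_atP [iA Ai]].
apply: (card_leq_inj (f := fun i => (tnth P i).2)) => [|x xA].
  by apply: ltn_inj_in => l m; apply: chain_lt_col.
rewrite ltnS; have := Ai x xA; rewrite leq_eqVlt => /orP [/eqP/val_inj -> //|xi].
exact/ltnW/(chain_lt_col cA).
Qed.

Lemma len_dec_leq i : len true s i <= (tnth P i).1.+1.
Proof.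
apply/bigmax_leqP => A /andP [cA /ends_atP [iA Ai]].
apply: (card_leq_inj (f := fun i => (tnth P i).1)) => [|x xA].
  by apply: ltn_inj_in => l m; apply: chain_lt_row.
rewrite ltnS; have := Ai x xA; rewrite leq_eqVlt => /orP [/eqP/val_inj -> //|xi].
exact/ltnW/(chain_lt_row cA).
Qed.

(* Both maps are bijections onto the rectangle and one dominates the other,
   so they agree. *)
Lemma matches_esbox (hi : avoids false k s) (hd : avoids true j s) i :
  esbox hi hd i = tnth P i.
Proof.
pose ht (a : B) := a.1 + a.2.
have le l : ((esbox hi hd l).1 <= (tnth P l).1) && ((esbox hi hd l).2 <= (tnth P l).2).
  by have := len_inc_leq l; have := len_dec_leq l; rewrite /=; lia.
have cardB : #|{: B}| <= #|'I_N| by rewrite card_prod !card_ord.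
have bij (f : 'I_N -> B) : injective f -> \sum_i ht (f i) = \sum_(a : B) ht a.
  move=> fi; rewrite [RHS](reindex f) //=.
  by apply: onW_bij; apply: inj_card_bij.

have e : \sum_l ht (esbox hi hd l) = \sum_l ht (tnth P l).
  by rewrite !bij //; [exact: tnth_inj | exact: esbox_inj].
have lel l : true -> ht (esbox hi hd l) <= ht (tnth P l)
    ?= iff (ht (esbox hi hd l) == ht (tnth P l)).
  by move=> _; apply/leqif_eq; have := le l; rewrite /ht; lia.
have [_] := leqif_sum lel; rewrite e eqxx => /esym/forall_inP/(_ i isT)/eqP.
have := le i; rewrite /ht; move: (esbox hi hd i) (tnth P i) => [a1 a2] [b1 b2] /= H E.
by congr (_, _); apply: val_inj => /=; lia.
Qed.
End Matching.

Lemma matches_inj s P Q P' Q' :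
  lin_ordered P -> lin_ordered Q -> lin_ordered P' -> lin_ordered Q' ->
  matches s P Q -> matches s P' Q' -> P = P' /\ Q = Q'.
Proof.
move=> lP lQ lP' lQ' h h'.
have hi := matches_avoids_inc lP lQ h; have hd := matches_avoids_dec lP lQ h.
have e i : tnth P i = tnth P' i.
  by rewrite -(matches_esbox lP lQ h hi hd) (matches_esbox lP' lQ' h').
split; apply: eq_from_tnth => // i.
by rewrite -(permKV s i) -h -h' e.
Qed.

Lemma matches_exists s : avoids false k s -> avoids true j s ->
  exists P Q, [/\ lin_ordered P, lin_ordered Q & matches s P Q].
Proof.
move=> hi hd; pose f := esbox hi hd.
exists (mktuple f), (mktuple (fun v => flipbox (f (s^-1%g v)))); split.
- apply: lin_ordered_tupleP => i l il; rewrite !tnth_mktuple; apply/negP => /andP [h1 h2].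
  case/orP: (perm_ltn_total s il) => lt.
    by have := esbox2 hi hd il lt; rewrite ltnNge h2.
  by have := esbox1 hi hd il lt; rewrite ltnNge h1.
- apply: lin_ordered_tupleP => v v' vv; rewrite !tnth_mktuple flipbox_ble.
  have := permKV s v; have := permKV s v'; move: (s^-1%g v) (s^-1%g v') => i i' ei' ei.
  rewrite -ei -ei' in vv; apply/negP => /andP [h1 h2].
  case: (ltngtP i i') => [lt|lt|/val_inj e].
  - by have := esbox2 hi hd lt vv; rewrite ltnNge h2.
  - by have := esbox1 hi hd lt vv; rewrite ltnNge h1.
  - by rewrite e ltnn in vv.
- by move=> i; rewrite !tnth_mktuple permK.
Qed.

Lemma matches_perm P Q : lin_ordered P -> lin_ordered Q -> exists s, matches s P Q.
Proof.
move=> lP lQ.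
have [g Kg gK] : bijective (tnth Q).
  by apply: inj_card_bij; [exact: tnth_inj | rewrite card_prod !card_ord].
have inj : injective (fun i => g (flipbox (tnth P i))).
  by move=> i l /(can_inj gK)/(can_inj flipboxK)/(tnth_inj lP).
by exists (perm inj) => i; rewrite permE gK.
Qed.

Lemma matches_uniq s s' P Q : lin_ordered Q -> matches s P Q -> matches s' P Q -> s = s'.
Proof. by move=> lQ h h'; apply/permP => i; apply: (tnth_inj lQ); rewrite -h -h'. Qed.

Definition rotate_tuple P : N.-tuple B := mktuple (fun i => rotbox (tnth P (rev_ord i))).

Lemma rotate_tupleE P : rotate_tuple P = rotate P :> seq B.
Proof.
have [N0|N0] := posnP N.
  have nilE (t : N.-tuple B) : t = [::] :> seq B by apply/nilP; rewrite /nilp size_tuple N0.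
  by rewrite !nilE.
have [d _] : exists d : B, d = d by exists (tnth P (Ordinal N0)).
apply: (eq_from_nth (x0 := d)); first by rewrite size_rotate !size_tuple.
rewrite size_tuple => i lt; rewrite -[i]/(val (Ordinal lt)) -tnth_nth tnth_mktuple.
rewrite (tnth_nth d) /rotate nth_rev size_map size_tuple //.
by rewrite (nth_map d) // size_tuple; lia.
Qed.

Lemma matches_rotate s P Q : matches s P Q ->
  rotate_tuple P = P -> rotate_tuple Q = Q -> lin_ordered Q -> central s.
Proof.
move=> h eP eQ lQ.
have rP i : tnth P (rev_ord i) = rotbox (tnth P i) by rewrite -{1}eP tnth_mktuple rev_ordK.
have rQ i : tnth Q (rev_ord i) = rotbox (tnth Q i) by rewrite -{1}eQ tnth_mktuple rev_ordK.
by apply/forallP => i; apply/eqP/(tnth_inj lQ); rewrite -h rP rQ -h.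
Qed.

(** The rotated words match the rotated permutation, which is [s] itself by symmetry, and [s]
    determines its pair of words. *)
Lemma matches_symmetric s P Q : lin_ordered P -> lin_ordered Q -> matches s P Q ->
  central s -> rotate_tuple P = P /\ rotate_tuple Q = Q.
Proof.
move=> lP lQ h /forallP sym.
have lr (t : N.-tuple B) : lin_ordered t -> lin_ordered (rotate_tuple t).
  move=> lt; have := @linext_rotate j k t.
  by rewrite /linext size_rotate size_tuple eqxx /= rotate_tupleE; apply.
apply: (@matches_inj s) => //; try exact: lr.
move=> i; rewrite !tnth_mktuple -(eqP (sym i)) -h.
by rewrite /flipbox /rotbox /= rev_ordK.
Qed.

Lemma card_symmetric_avoiding :
  #|[set s : {perm 'I_N} | central s & avoids false k s && avoids true j s]| =
  #|[set t : N.-tuple B | lin_ordered t & rotate t == t]| ^ 2.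
Proof.
set X := [set t : N.-tuple B | _ & _]; pose F (p : N.-tuple B * N.-tuple B) : {perm 'I_N} :=
  odflt 1%g [pick s : {perm 'I_N} | [forall i, flipbox (tnth p.1 i) == tnth p.2 (s i)]].
have XE t : t \in X = lin_ordered t && (rotate_tuple t == t).
  by rewrite inE -rotate_tupleE.
have FP P Q : lin_ordered P -> lin_ordered Q -> matches (F (P, Q)) P Q.
  move=> lP lQ; rewrite /F; case: pickP => [s /forallP h i|no]; first exact/eqP.
  have [s h] := matches_perm lP lQ; have /negP := no s; case; apply/forallP => i.
  exact/eqP.
rewrite -[RHS]mulnn -cardsX -(card_in_imset (f := F)).
  apply: eq_card => s; apply/idP/imsetP => [|[[P Q]]].
    rewrite inE => /and3P [sym hi hd].
    have [P [Q [lP lQ h]]] := matches_exists hi hd.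
    have [eP eQ] := matches_symmetric lP lQ h sym.
    exists (P, Q); first by rewrite in_setX !XE lP lQ eP eQ !eqxx.
    exact: matches_uniq lQ h (FP _ _ lP lQ).
  rewrite in_setX !XE => /andP [/andP [lP /eqP eP] /andP [lQ /eqP eQ]] ->.
  have h := FP _ _ lP lQ.
  rewrite inE (matches_rotate h) //= (matches_avoids_inc lP lQ h).
  exact: matches_avoids_dec lP lQ h.
move=> [P Q] [P' Q'] /=; rewrite !inE /= => /andP [/andP [lP _] /andP [lQ _]].
move=> /andP [/andP [lP' _] /andP [lQ' _]] e.
have h := FP _ _ lP lQ; have h' := FP _ _ lP' lQ'; rewrite -e in h'.
by have [-> ->] := matches_inj lP lQ lP' lQ' h h'.
Qed.

End Bijection.

(** * From signed permutations to centrally symmetric ones *)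

(* For [e = true] the index set [±n] misses the middle element of 'I_N. *)
Section Transfer.
Variables (n N : nat) (e : bool).
Hypothesis hN : N = n + n + e.
Implicit Types (s : {perm 'I_N}) (w : {perm pmidx n}) (x y : pmidx n).

(** The rank of the integer [x] in increasing order; for [e = true] the value [n] is skipped,
    leaving room for the integer 0. *)
Definition rank_nat x : nat := if x.1 then n.-1 - x.2 else n + e + x.2.

Lemma rank_lt x : rank_nat x < N.
Proof. by rewrite /rank_nat; have := ltn_ord x.2; case: x.1; lia. Qed.

Definition rank x : 'I_N := Ordinal (rank_lt x).

Lemma rank_ltn x y : (rank x < rank y) = (pmval x < pmval y)%R.
Proof.
rewrite /= /rank_nat /pmval; have := ltn_ord x.2; have := ltn_ord y.2.
by case: x.1; case: y.1; lia.
Qed.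

Lemma rank_inj : injective rank.
Proof.
move=> x y /(congr1 val) /= E; apply: (@pmval_inj n); apply: le_anti.
by rewrite !leNgt -!rank_ltn /= E ltnn.
Qed.

Lemma rank_neg x : rank (pmneg x) = rev_ord (rank x).
Proof.
apply: val_inj; rewrite /= /rank_nat /pmneg; have := ltn_ord x.2.
by case: x => [[] i] /=; lia.
Qed.

Definition middle (i : 'I_N) := e && (i == n :> nat).

Lemma rank_middle x : ~~ middle (rank x).
Proof. by rewrite /middle /= /rank_nat; have := ltn_ord x.2; case: x.1 => /=; lia. Qed.

Lemma rankP (i : 'I_N) : ~~ middle i -> exists x, rank x = i.
Proof.
rewrite /middle => mi; have iN := ltn_ord i; have [lt|ge] := ltnP i n.
  have lt' : n.-1 - i < n by lia.
  by exists (true, Ordinal lt'); apply: val_inj; rewrite /= /rank_nat /=; lia.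
have lt' : i - (n + e) < n by lia.
by exists (false, Ordinal lt'); apply: val_inj; rewrite /= /rank_nat /=; lia.
Qed.

Lemma middle_uniq (i l : 'I_N) : middle i -> middle l -> i = l.
Proof. by move=> /andP [_ /eqP mi] /andP [_ /eqP ml]; apply: val_inj; rewrite /= mi ml. Qed.

Definition extends s w := forall x, s (rank x) = rank (w x).

Lemma extends_middle s w i : extends s w -> middle i -> s i = i.
Proof.
move=> sw mi; apply: middle_uniq (mi); apply/negPn/negP => /rankP [y ey].
have : s (rank (w^-1%g y)) = s i by rewrite sw permKV.
by move/perm_inj => E; have := rank_middle (w^-1%g y); rewrite E mi.
Qed.

Lemma extends_exists w : exists s, extends s w.
Proof.
pose f i := if [pick x | rank x == i] is Some x then rank (w x) else i.
have f1 x : f (rank x) = rank (w x).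
  rewrite /f; case: pickP => [y /eqP/rank_inj -> //|/(_ x)]; by rewrite eqxx.
have f2 i : middle i -> f i = i.
  rewrite /f; case: pickP => // x /eqP <- m; by have := rank_middle x; rewrite m.
have inj : injective f.
  move=> i l; have [mi|/rankP [x <-]] := boolP (middle i);
    have [ml|/rankP [y <-]] := boolP (middle l).
  - by move=> _; apply: middle_uniq.
  - by rewrite f1 f2 // => E; have := rank_middle (w y); rewrite -E mi.
  - by rewrite f1 f2 // => E; have := rank_middle (w x); rewrite E ml.
  - by rewrite !f1 => /rank_inj/perm_inj ->.
by exists (perm inj) => x; rewrite permE.
Qed.

Lemma extends_uniq s s' w : extends s w -> extends s' w -> s = s'.
Proof.
move=> h h'; apply/permP => i; have [mi|/rankP [x <-]] := boolP (middle i).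
  by rewrite (extends_middle h) // (extends_middle h').
by rewrite h h'.
Qed.

Lemma extends_inj s w w' : extends s w -> extends s w' -> w = w'.
Proof. by move=> h h'; apply/permP => x; apply: rank_inj; rewrite -h -h'. Qed.

Lemma middle_rev i : middle i -> rev_ord i = i.
Proof. by rewrite /middle => /andP [e1 /eqP E]; apply: val_inj; rewrite /=; lia. Qed.

Lemma rev_middle i : rev_ord i = i -> middle i.
Proof. by move/(congr1 val) => /=; rewrite /middle; have := ltn_ord i; lia. Qed.

Lemma extends_signed s w : extends s w -> (w \in signed_perms n) = central s.
Proof.
move=> h; rewrite inE; apply/forallP/forallP => H.
  move=> i; have [mi|/rankP [x <-]] := boolP (middle i).
    by rewrite middle_rev // (extends_middle h) // middle_rev.
  by rewrite -rank_neg !h -rank_neg (eqP (H x)).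
by move=> x; apply/eqP/rank_inj; rewrite -h !rank_neg (eqP (H _)) h.
Qed.

Lemma central_extends s : central s -> exists w, extends s w.
Proof.
move=> /forallP cs.
have fix_ i : middle i -> s i = i.
  move=> mi; apply: middle_uniq (mi); apply: rev_middle.
  by rewrite -(eqP (cs i)) middle_rev.
have ex x : exists y, rank y == s (rank x).
  have [|y ey] := @rankP (s (rank x)); last by exists y; apply/eqP.
  apply/negP => m; have := rank_middle x; move: (m); rewrite -{1}(fix_ _ m).
  by move=> _; have := fix_ _ m => /perm_inj <-; rewrite m.
pose f x := xchoose (ex x).
have fE x : rank (f x) = s (rank x) by apply/eqP/(xchooseP (ex x)).
have inj : injective f by move=> x y /(congr1 rank); rewrite !fE => /perm_inj/rank_inj.
by exists (perm inj) => x; rewrite permE fE.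
Qed.

Definition pattern (b : bool) (m : nat) : 'S_m :=
  if b then decreasing_pattern m else increasing_pattern m.

Lemma pattern_ltn b m (x y : 'I_m) : x != y ->
  (pattern b m x < pattern b m y) = (x < y) (+) b.
Proof.
rewrite -val_eqE /= => xy; case: b; rewrite /pattern ?permE ?perm1 /= ?addbF ?addbT //.
by have := ltn_ord x; have := ltn_ord y; lia.
Qed.

Lemma avoids_globally b m s w : extends s w -> avoids b m s ->
  globally_avoids w (pattern b m.+1).
Proof.
move=> h /avoidsP av; apply/negP => /existsP [i /andP [/forallP mono /forallP pat]].
have mono' (x y : 'I_m.+1) : x < y -> rank (i x) < rank (i y).
  by rewrite rank_ltn => xy; have /forallP/(_ y)/implyP := mono x; apply.
have inj : injective (rank \o i).
  move=> x y /= E; apply: val_inj; case: (ltngtP x y) => // /mono'; by rewrite E ltnn.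
have : #|[set (rank \o i) x | x in 'I_m.+1]| <= m.
  apply: av; apply/chainP => _ _ /imsetP [x _ ->] /imsetP [y _ ->] /= lt.
  have xy : x < y.
    case: (ltngtP x y) => // [yx|E].
      by have := ltn_trans lt (mono' _ _ yx); rewrite ltnn.
    by rewrite (val_inj E) ltnn in lt.
  rewrite !h rank_ltn; have /forallP/(_ y)/eqP -> := pat x.
  by rewrite pattern_ltn -?val_eqE /= ?xy //; lia.
by rewrite card_imset // card_ord ltnn.
Qed.

Lemma enum_pairwise (A : {set 'I_N}) : pairwise (fun x y : 'I_N => x < y) (enum A).
Proof.
have : pairwise ltn (map val (enum 'I_N)).
  by rewrite val_enum_ord -sorted_pairwise ?iota_ltn_sorted //; exact: ltn_trans.
have -> : enum A = [seq x <- enum 'I_N | x \in A] by rewrite enumT.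
by rewrite pairwise_map; apply/subseq_pairwise/filter_subseq.
Qed.

Lemma globally_avoids_chain b m s w (A : {set 'I_N}) : extends s w ->
  globally_avoids w (pattern b m.+1) -> chain b s A ->
  (forall i, i \in A -> ~~ middle i) -> #|A| <= m.
Proof.
move=> h av /chainP cA nm; rewrite leqNgt; apply: contra av => lt.
have [d dA] : exists d, d \in A by apply/card_gt0P; lia.
have ex (a : 'I_m.+1) : exists x, rank x == nth d (enum A) a.
  have [|x ex] := @rankP (nth d (enum A) a); last by exists x; apply/eqP.
  apply: nm; rewrite -mem_enum mem_nth // -cardE; exact: leq_trans (ltn_ord a) lt.
pose f a := xchoose (ex a).
have fE a : rank (f a) = nth d (enum A) a by apply/eqP/(xchooseP (ex a)).
have inA a : rank (f a) \in A.
  by rewrite fE -mem_enum mem_nth // -cardE; exact: leq_trans (ltn_ord a) lt.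
have mono (x y : 'I_m.+1) : x < y -> rank (f x) < rank (f y).
  move=> xy; rewrite !fE; apply: (pairwiseP d (enum_pairwise A)) => //; rewrite inE -cardE.
    exact: leq_trans (ltn_ord x) lt.
  exact: leq_trans (ltn_ord y) lt.
apply/existsP; exists [ffun a => f a]; apply/andP; split.
  apply/forallP => x; apply/forallP => y; apply/implyP => xy; rewrite !ffunE -rank_ltn.
  exact: mono.
apply/forallP => x; apply/forallP => y; rewrite !ffunE -rank_ltn -!h; apply/eqP.
case: (ltngtP x y) => [xy|yx|/val_inj ->]; last by rewrite !ltnn.
  have := cA _ _ (inA x) (inA y) (mono _ _ xy).
  rewrite pattern_ltn ?xy; last by rewrite -val_eqE /=; lia.
  by clear; case: (_ < _); case: b.
have := cA _ _ (inA y) (inA x) (mono _ _ yx); rewrite pattern_ltn -?val_eqE /=; last by lia.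
have : s (rank (f x)) != s (rank (f y)).
  by rewrite (inj_eq perm_inj) -val_eqE /=; have := mono _ _ yx; rewrite /=; lia.
by rewrite -val_eqE /=; move: yx; clear; case: b => /=; lia.
Qed.

(* The lower half of a chain through the middle can be reflected. *)
Lemma half_chain b m s w (A : {set 'I_N}) c : extends s w -> central s ->
  globally_avoids w (pattern b m.+1) -> chain b s A -> c \in A -> middle c ->
  #|[set i in A | i < c]|.*2 <= m.
Proof.
move=> h cs av /chainP cA cin mc; set L := [set i in A | _].
have sc := extends_middle h mc; have [_ /eqP cn] := andP mc; have [e1 _] := andP mc.
have Lp i : i \in L -> [/\ i \in A, i < c & (s i < n) (+) b].
  rewrite inE => /andP [iA ic]; split=> //.
  by have := cA i c iA cin ic; rewrite sc cn.
have sL i : i \in L -> s i != n :> nat.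
  move=> /Lp [_ ic _]; apply/eqP => E; have : s i = s c by apply: val_inj; rewrite sc /= E cn.
  by move/perm_inj => ei; rewrite ei ltnn in ic.
have srev i : s (rev_ord i) = rev_ord (s i) by apply/eqP; move/forallP: cs.
rewrite -addnn -[X in _ + X](card_imset (mem L) (@rev_ord_inj N)) -cardsUI.
have -> : L :&: (@rev_ord N) @: L = set0.
  apply/setP => i; rewrite !inE; apply/negP => /andP [/andP [_ ic] /imsetP [l /Lp [_ lc _] E]].
  by move: ic lc; rewrite E cn /=; have := ltn_ord l; lia.
rewrite cards0 addn0; apply: (globally_avoids_chain h av).
  apply/chainP => x y; rewrite !in_setU.
  move=> /orP [xL|/imsetP [x' xL ->]] /orP [yL|/imsetP [y' yL ->]].
  - by have [xA _ _] := Lp x xL; have [yA _ _] := Lp y yL; exact: cA.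
  - have [_ xc sx] := Lp x xL; have [_ yc sy] := Lp y' yL; move=> _; rewrite srev.
    have := sL x xL; have := sL y' yL; have := ltn_ord (s y'); rewrite /=.
    by move: sx sy; clear -hN e1; case: b => /=; lia.
  - have [_ xc _] := Lp x' xL; have [_ yc _] := Lp y yL.
    by have := ltn_ord x'; rewrite /=; lia.
  - have [xA _ _] := Lp x' xL; have [yA _ _] := Lp y' yL; move=> lt.
    have lt' : y' < x' by have := ltn_ord x'; have := ltn_ord y'; move: lt; rewrite /=; lia.
    have := cA _ _ yA xA lt'; rewrite !srev /=; have := ltn_ord (s x'); have := ltn_ord (s y').
    by clear; case: b => /=; lia.
move=> i; rewrite in_setU /middle => /orP [/Lp [_ ic _]|/imsetP [l /Lp [_ lc _] ->]].
  by apply/negP; lia.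
by apply/negP => /=; have := ltn_ord l; lia.
Qed.

(** For a chain through the middle, [half_chain] bounds twice each half by [m], the upper half being
    the lower half of the rotated chain [A']. Doubling a half may lose the middle point, so the
    count is short by one; as [m] is odd, an even number at most [m] is at most [m.-1], which makes
    up for it. *)
Lemma avoids_transfer b m s w : extends s w -> central s -> (e -> odd m) ->
  globally_avoids w (pattern b m.+1) = avoids b m s.
Proof.
move=> h cs om; apply/idP/idP => [av|]; last exact: avoids_globally.
apply/avoidsP => A cA.
have [c /andP [cin mc]|no] := pickP [pred c in A | middle c]; last first.
  by apply: (globally_avoids_chain h av cA) => i iA; have /= := no i; rewrite iA /= => ->.
have [e1 /eqP cn] := andP mc.
have srev i : s (rev_ord i) = rev_ord (s i) by apply/eqP; move/forallP: cs.
pose A' := (@rev_ord N) @: A.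
have cA' : chain b s A'.
  apply/chainP => _ _ /imsetP [x xA ->] /imsetP [y yA ->] lt.
  have lt' : y < x by have := ltn_ord x; have := ltn_ord y; move: lt; rewrite /=; lia.
  have := (chainP _ _ _ cA) _ _ yA xA lt'; rewrite !srev /=.
  by have := ltn_ord (s x); have := ltn_ord (s y); clear; case: b => /=; lia.
have cin' : c \in A' by rewrite -(middle_rev mc); apply: imset_f.
have lo := half_chain h cs av cA cin mc; have hi := half_chain h cs av cA' cin' mc.
have sub : A \subset c |: ([set i in A | i < c] :|: (@rev_ord N) @: [set i in A' | i < c]).
  apply/subsetP => i iA; rewrite !inE iA /=.
  case: (ltngtP i c) => [lt|lt|/val_inj ->]; rewrite ?eqxx ?orbT //.
  rewrite orFb; apply/orP; right; apply/imsetP; exists (rev_ord i); last by rewrite rev_ordK.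
  by rewrite inE imset_f //=; have := ltn_ord i; lia.
have le : #|A| <= 1 + (#|[set i in A | i < c]| + #|[set i in A' | i < c]|).
  apply: leq_trans (subset_leq_card sub) _; rewrite cardsU1 leq_add ?leq_b1 //.
  by rewrite -[X in _ + X](card_imset _ (@rev_ord_inj N)) leq_card_setU.
apply: leq_trans le _; have := om e1; move: lo hi; clear.
by move: #|_| #|_| => p q; lia.
Qed.

Lemma card_signed_avoiding j k : (e -> odd j && odd k) ->
  #|[set w in signed_perms n |
      globally_avoids w (increasing_pattern k.+1) &&
      globally_avoids w (decreasing_pattern j.+1)]| =
  #|[set s : {perm 'I_N} | central s & avoids false k s && avoids true j s]|.
Proof.
move=> ejk; pose F w : {perm 'I_N} :=
  odflt 1%g [pick s : {perm 'I_N} | [forall x, s (rank x) == rank (w x)]].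
have FP w : extends (F w) w.
  rewrite /F; case: pickP => [s /forallP h x|no]; first exact/eqP.
  have [s h] := extends_exists w; have /negP := no s; case; apply/forallP => x; exact/eqP.
have T b m s w : extends s w -> central s -> (e -> odd m) ->
  globally_avoids w (if b then decreasing_pattern m.+1
                     else increasing_pattern m.+1) = avoids b m s.
  exact: avoids_transfer.
rewrite -(card_in_imset (f := F)).
  apply: eq_card => s; apply/imsetP/idP => [[w] | ].
    rewrite [_ \in _]in_set => /andP [sw /andP [a1 a2]] ->.
    have cs : central (F w) by rewrite -(extends_signed (FP w)).
    rewrite in_set cs -(T false k _ _ (FP w) cs); last by case/ejk/andP.
    by rewrite -(T true j _ _ (FP w) cs) ?a1 //; case/ejk/andP.
  rewrite in_set => /and3P [cs a1 a2]; have [w h] := central_extends cs.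
  exists w; last exact: extends_uniq h (FP w).
  rewrite in_set (extends_signed h) cs (T false k _ _ h cs); last by case/ejk/andP.
  by rewrite (T true j _ _ h cs) ?a1 //; case/ejk/andP.
move=> w w' _ _ E; apply: extends_inj (FP w) _; rewrite E; exact: FP.
Qed.
End Transfer.

Theorem proposition6p7 (j k : nat) (hj : (1 <= j)%N) (hk : (1 <= k)%N) :
  (forall (n : nat) (w : {perm pmidx n}),
     w \in signed_perms n ->
     globally_avoids w (increasing_pattern k.+1) ->
     globally_avoids w (decreasing_pattern j.+1) ->
     (n%:R <= (k * j)%:R / 2 :> rat)%R) /\
  #|[set w in signed_perms (k * j)./2 |
      globally_avoids w (increasing_pattern k.+1) &&
      globally_avoids w (decreasing_pattern j.+1)]|
  = (#|domino_tableaux (near_rectangle j k)| ^ 2)%N.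
Proof.
split=> [n w sw ai ad|].
  (* For the inequality no middle point is added: Erdos-Szekeres on the [n + n] points suffices. *)
  have hN : n + n = n + n + false by rewrite addn0.
  have [s h] := extends_exists hN w.
  have cs : central s by rewrite -(extends_signed h).
  have hi : avoids false k s by rewrite -(avoids_transfer false h cs).
  have hd : avoids true j s by rewrite -(avoids_transfer true h cs).
  have := erdos_szekeres hi hd; rewrite mulnC => le.
  by rewrite ler_pdivlMr ?ltr0n // -natrM ler_nat muln2 -addnn.
(* Here a middle point is added exactly when [k * j] is odd, so that the number of points is the
   extremal [j * k]. Then both [j] and [k] are odd, as the transfer of avoidance requires. *)
have hN : j * k = (k * j)./2 + (k * j)./2 + odd (k * j).
  by rewrite mulnC addnn -[in LHS](odd_double_half (k * j)) addnC.
rewrite (card_signed_avoiding hN); last by rewrite oddM andbC.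
have := card_symmetric_avoiding j k; rewrite card_symmetric_paired (card_paired_domino hj hk).
exact.
Qed.
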